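(* Let $X$ and $X'$ be two random vectors in $\mathbb{R}^k$, defined on the same probability space, with the same distribution, and let $Z=(Z_1,\ldots,Z_k)$ be a standard Gaussian random vector in $\mathbb{R}^k$ (independent $N(0,1)$ coordinates). Let $\sigma>0$, and suppose there is a constant $\lambda>0$ such that $$\frac{1}{\lambda}\,\mathbb{E}\left[X'-X\,\middle|\,X\right]=-X .$$ Let $E$ be a random $k\times k$ real matrix satisfying $$\frac{1}{2\lambda}\,\mathbb{E}\left[(X'-X)(X'-X)^T\,\middle|\,X\right]=\sigma^2 I_k+\mathbb{E}\left[E\,\middle|\,X\right].$$ Then for every $g\in C^2(\mathbb{R}^k)$ with $M_1(g)<\infty$ and $M_2(g)<\infty$, $$\left|\mathbb{E}\,g(X)-\mathbb{E}\,g(\sigma Z)\right|\le \frac{1}{\sigma}\,M_1(g)\,\mathbb{E}\|E\|_{H.S.}+\frac{\sqrt{2\pi}}{24\,\sigma}\,\frac{M_2(g)}{\lambda}\,\mathbb{E}|X'-X|^3 .$$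
   Context: $|\cdot|$ is the Euclidean norm on $\mathbb{R}^k$; $I_k$ is the $k\times k$ identity matrix; $\|A\|_{H.S.}=\sqrt{\operatorname{Tr}(AA^T)}$ is the Hilbert–Schmidt norm of a real matrix. For $g:\mathbb{R}^k\to\mathbb{R}$, $$M_1(g)=\sup_{x\ne y}\frac{|g(x)-g(y)|}{|x-y|},\qquad M_2(g)=\sup_{x\neq y}\frac{|\nabla g(x)-\nabla g(y)|}{|x-y|}\ \ (\text{for } g\in C^1).$$ The random variables whose conditional expectations appear in the hypotheses are assumed integrable, so that these conditional expectations are well defined ($X'-X$ is square integrable and $E$ is integrable). The identities between conditional expectations hold almost surely. $X$ and $X'$ are not required to be exchangeable. *)

(* Defs.v *)
(* MathComp-Analysis *)
From HB Require Import structures.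
From mathcomp Require Import all_boot all_order all_algebra.
From mathcomp Require Import all_classical all_reals all_analysis.

Set Implicit Arguments.
Unset Strict Implicit.
Unset Printing Implicit Defensive.

Import Order.TTheory GRing.Theory Num.Theory.
Import numFieldNormedType.Exports.

Local Open Scope classical_set_scope.
Local Open Scope ring_scope.

(* Real matrices with their Borel sigma-algebra; R^k is represented by the row
   vectors 'rV[R]_k = 'M[R]_(1, k), so (x x^T) for a column vector x reads
   x^T *m x here. *)
Notation borel_mx R m n := (g_sigma_algebraType (@open 'M[R]_(m, n))).

Section norms.
Context {R : realType}.

(* The library norm `|x| on matrices is the max norm, hence these two. *)
Definition enorm k (x : 'rV[R]_k) : R := Num.sqrt (\sum_(i < k) x 0 i ^+ 2).

Definition hs_norm k (A : 'M[R]_k) : R := Num.sqrt (\tr (A *m A^T)).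

End norms.

Section smooth_functions.
Context {R : realType} {k : nat}.
Implicit Type g : 'rV[R]_k -> R.

Definition partial (i : 'I_k) g : 'rV[R]_k -> R := 'D_(delta_mx 0 i) g.

Definition gradient g (x : 'rV[R]_k) : 'rV[R]_k := \row_i partial i g x.

Definition is_C1 g : Prop :=
  forall i : 'I_k,
    (forall x, derivable g x (delta_mx 0 i)) /\ continuous (partial i g).

Definition is_C2 g : Prop := is_C1 g /\ forall i : 'I_k, is_C1 (partial i g).

Definition M1 g : \bar R :=
  ereal_sup [set (`|g p.1 - g p.2| / enorm (p.1 - p.2))%:E
            | p in [set p : 'rV[R]_k * 'rV[R]_k | p.1 <> p.2]].

Definition M2 g : \bar R :=
  ereal_sup
    [set (enorm (gradient g p.1 - gradient g p.2) / enorm (p.1 - p.2))%:E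
    | p in [set p : 'rV[R]_k * 'rV[R]_k | p.1 <> p.2]].

End smooth_functions.

Section probability_notions.
Context {R : realType} {d : measure_display} {T : measurableType d}.
Variable P : probability T R.

Definition same_distribution d' (T' : measurableType d')
    (X Y : {RV P >-> T'}) : Prop :=
  forall A : set T', measurable A -> distribution P X A = distribution P Y A.

Definition mutually_independent (I : finType) (Y : I -> T -> R) : Prop :=
  forall (J : {set I}) (A : I -> set R), (forall i, measurable (A i)) ->
    P (\bigcap_(i in [set` J]) (Y i @^-1` A i)) =
    (\prod_(i in J) P (Y i @^-1` A i))%E.

Definition standard_gaussian k (Z : {RV P >-> borel_mx R 1 k}) : Prop :=
  mutually_independent (fun (i : 'I_k) w => (Z w : 'rV[R]_k) 0 i) /\
  forall (i : 'I_k) (A : set R), measurable A ->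
    P ((fun w => (Z w : 'rV[R]_k) 0 i) @^-1` A) = normal_prob 0 1 A.

(* V is a version of E[Y | X] *)
Definition is_cond_exp d' (T' : measurableType d') (X : {RV P >-> T'})
    (Y V : T -> R) : Prop :=
  [/\ P.-integrable setT (EFin \o Y),
      P.-integrable setT (EFin \o V),
      (forall B : set R, measurable B ->
         g_sigma_algebra_preimage X (V @^-1` B)) &
      (forall A : set T, g_sigma_algebra_preimage X A ->
         (\int[P]_(w in A) (V w)%:E = \int[P]_(w in A) (Y w)%:E)%E)].

Definition is_cond_exp_mx d' (T' : measurableType d') (X : {RV P >-> T'})
    m n (Y V : T -> 'M[R]_(m, n)) : Prop :=
  forall i j, is_cond_exp X (fun w => Y w i j) (fun w => V w i j).

Definition increment k (X X' : {RV P >-> borel_mx R 1 k}) (w : T) : 'rV[R]_k :=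
  (X' w : 'rV[R]_k) - (X w : 'rV[R]_k).

End probability_notions.

(* Main.v *)
(* Interpolate along Y_t = sin t X + cos t sigma Z for t in [0, pi/2], with X and Z
   independent; only iterated integrals in X and Z are used.  With s = sin t and
   r = sigma cos t, the smoothed function u x = E g(s x + r Z) satisfies
   d/dt u x = cos t <G x, x> - s sigma tr (H x), where G x = E (grad g)(s x + r Z)
   and H x = E Z (grad g)(s x + r Z)^T.
   Gaussian integration by parts shows that s G and (s^2 / r) H are the gradient and
   the Hessian of u.  Since X and X' have the same law, E u(X') - E u(X) = 0; the
   Taylor expansion of u at X to second order, with the two conditional expectation
   hypotheses, therefore expresses the derivative of E g(Y_t) through E <H X, E> and
   the Taylor remainder.  Bessel's inequality gives |H x|_HS <= M_1(g), and
   E |<Z, v>| = sqrt(2 / pi) |v| bounds the Lipschitz constant of the Hessian of u.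
   The derivative is thus at most sin t M_1(g) E|E| / sigma + sin^2 t times
   sqrt(2 / pi) M_2(g) E|X' - X|^3 / (6 lambda sigma), and the integrals of sin and
   sin^2 over [0, pi/2] are 1 and pi/4. *)

Require Import Defs.
From HB Require Import structures.
From mathcomp Require Import all_boot all_order all_algebra.
From mathcomp Require Import all_classical all_reals all_analysis.
From mathcomp Require Import measurable_realfun lebesgue_integral_under.
From mathcomp Require Import normal_distribution ring lra.

Set Implicit Arguments.
Unset Strict Implicit.
Unset Printing Implicit Defensive.

Import Order.TTheory GRing.Theory Num.Theory.
Import numFieldNormedType.Exports.

Local Open Scope classical_set_scope.
Local Open Scope ring_scope.

(** * Integrable real functions *)

(** The function [g] is only C^2, so the second-order Taylor remainder has to be controlled by a
    Lipschitz bound on the Hessian of [u] in terms of [M_2(g)]. One integration by parts moves a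
    derivative from [g] to the Gaussian weight and makes this possible, at the price of a factor
    [1 / r] that is singular where [cos t = 0]. The first-order term of the path derivative carries
    a factor [cos t], which cancels this singularity. With [r = sigma cos t] the [sigma^2 I_k] part
    of the second-order term also matches the trace term exactly. Sine and cosine, unlike square
    roots, keep the path differentiable at both ends. The hypothesis on [Z] gives its law on boxes
    only, so the law of [<Z, v>] is not at hand. Its mean absolute value is found by rotating [v] to
    a coordinate axis, along which a smoothed absolute value keeps its mean. *)

Notation integ mu f := (mu.-integrable setT (EFin \o f)).

Section real_integrable.
Context {R : realType} d (T : measurableType d).
Variable mu : {measure set T -> \bar R}.
Implicit Types f g : T -> R.

Lemma integ_measurable f : integ mu f -> measurable_fun setT f.
Proof. by move=> /measurable_int /measurable_EFinP. Qed.

Lemma integ_ext f g : f =1 g -> integ mu f -> integ mu g.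
Proof. by move=> fg; apply: eq_integrable => // x _ /=; rewrite fg. Qed.

Lemma integD f g : integ mu f -> integ mu g -> integ mu (fun x => f x + g x).
Proof. by move=> fi gi; have := integrableD measurableT fi gi;
  apply: eq_integrable. Qed.

Lemma integB f g : integ mu f -> integ mu g -> integ mu (fun x => f x - g x).
Proof. by move=> fi gi; have := integrableB measurableT fi gi;
  apply: eq_integrable. Qed.

Lemma integZ a f : integ mu f -> integ mu (fun x => a * f x).
Proof. by move=> fi; have := integrableZl measurableT a fi; apply: eq_integrable. Qed.

Lemma integ_sum (I : finType) (P : pred I) (f : I -> T -> R) :
  (forall i, P i -> integ mu (f i)) -> integ mu (fun x => \sum_(i | P i) f i x).
Proof.
move=> fi; have := @integrable_sum _ _ _ mu _ measurableT _ (index_enum I) P (fun i =>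
  EFin \o f i) fi.
by apply: eq_integrable => // x _ /=; rewrite -sumEFin.
Qed.

Lemma integ_norm f : integ mu f -> integ mu (fun x => `|f x|).
Proof. exact: integrable_norm. Qed.

Lemma integ_dom f g : measurable_fun setT f -> (forall x, `|f x| <= g x) ->
  integ mu g -> integ mu f.
Proof.
move=> mf fg; apply: le_integrable => //; first exact/measurable_EFinP.
by move=> x _ /=; rewrite lee_fin (le_trans (fg x))// ler_norm.
Qed.

Lemma integM f g (M : R) : measurable_fun setT f -> (forall x, `|f x| <= M) ->
  integ mu g -> integ mu (fun x => f x * g x).
Proof.
move=> mf fM gi; apply: (@integ_dom _ (fun x => M * `|g x|)).
- by apply: measurable_funM => //; exact: integ_measurable.
- by move=> x; rewrite normrM ler_wpM2r.
- exact/integZ/integ_norm.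
Qed.

Lemma Rint_sum (I : finType) (P : pred I) (f : I -> T -> R) :
  (forall i, P i -> integ mu (f i)) ->
  (\int[mu]_x (\sum_(i | P i) f i x) = \sum_(i | P i) \int[mu]_x f i x)%R.
Proof.
move=> fi; suff : forall s : seq I, integ mu (fun x => \sum_(i <- s | P i) f i x) /\
  (\int[mu]_x (\sum_(i <- s | P i) f i x) = \sum_(i <- s | P i) \int[mu]_x f i x)%R.
  by move=> /(_ (index_enum I))[].
elim => [|i s [si IH]].
  split; last by under eq_Rintegral do rewrite big_nil;
    rewrite big_nil Rintegral_cst// mul0r.
  by apply: (@integ_ext (fun=> 0)); [move=> x; rewrite big_nil|exact: integrable0].
under eq_Rintegral do rewrite big_cons.
rewrite big_cons; case: ifPn => Pi.
  split; last by rewrite RintegralD ?IH//; exact: fi.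
  by apply: integ_ext (integD (fi _ Pi) si) => x; rewrite big_cons Pi.
by split=> //; apply: integ_ext si => x; rewrite big_cons (negbTE Pi).
Qed.

Lemma Rint_ae f g : {ae mu, forall x, f x = g x} -> measurable_fun setT f ->
  measurable_fun setT g -> (\int[mu]_x f x = \int[mu]_x g x)%R.
Proof.
move=> fg mf mg; rewrite /Rintegral; congr fine.
apply: ae_eq_integral => //; [exact/measurable_EFinP|exact/measurable_EFinP|].
by apply: filterS fg => x /= -> _.
Qed.

Lemma integ_ae f g : {ae mu, forall x, f x = g x} -> measurable_fun setT g ->
  integ mu f -> integ mu g.
Proof.
move=> fg mg fi; apply/integrableP; split; first exact/measurable_EFinP.
have /integrableP[mf] := fi; congr (_ < _)%E.
apply: ae_eq_integral => //; [exact: measurableT_comp|apply: measurableT_comp => //;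
  exact/measurable_EFinP|].
by apply: filterS fg => x /= -> _.
Qed.

Lemma Rint_abs_le f g : measurable_fun setT f -> integ mu g ->
  (forall x, `|f x| <= g x) -> `|\int[mu]_x f x| <= \int[mu]_x g x.
Proof.
move=> mf gi fg; have fi := integ_dom mf fg gi.
apply: (le_trans (le_normr_Rintegral _ _)) => //.
by apply: le_Rintegral => //; exact: integ_norm.
Qed.

(** All the curves differentiated below are defined on the whole line with a domination uniform in
    [t], so the open interval around [a] needed for the local theorem can be arbitrary. *)
Lemma is_derive_under_integral (f f' : R -> T -> R) (G : T -> R) (a : R) :
  (forall t, integ mu (f t)) ->
  (forall (t : R) y, is_derive t 1 (f^~ y) (f' t y)) ->
  (forall t y, `|f' t y| <= G y) -> integ mu G ->
  is_derive a 1 (fun t => (\int[mu]_y f t y)%R) (\int[mu]_y f' a y)%R.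
Proof.
move=> fi df fG Gi.
have E t y : partial1of2 f t y = f' t y.
  by rewrite partial1of2E; have := df t y => H; rewrite derive_val.
have aI : `]a - 1, a + 1[%classic a.
  by rewrite /= in_itv /=; apply/andP; split; lra.
have D1 : forall x y, `]a - 1, a + 1[%classic x -> setT y -> derivable (f ^~ y) x 1.
  by move=> x y _ _; case: (df x y).
have Gub : forall x y, `]a - 1,
  a + 1[%classic x -> setT y -> `|partial1of2 f x y| <= G y.
  by move=> x y _ _; rewrite E.
have G0 y : 0 <= G y by apply: le_trans (fG a y).
apply: DeriveDef.
  exact: (derivable_under_integral measurableT aI (fun x _ => fi x) D1 G0 Gi Gub).
rewrite -derive1E (differentiation_under_integral measurableT aI (fun x _ =>
  fi x) D1 G0 Gi Gub).
by apply: eq_Rintegral => y _; rewrite E.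
Qed.

End real_integrable.

Section finite_integrable.
Context {R : realType} d (T : measurableType d) (P : probability T R).

Lemma integ_cst (a : R) : integ P (fun=> a).
Proof. exact: finite_measure_integrable_cst. Qed.

Lemma integ_bounded (f : T -> R) (M : R) : measurable_fun setT f ->
  (forall x, `|f x| <= M) -> integ P f.
Proof. by move=> mf fM; apply: integ_dom fM _ => //; exact: integ_cst. Qed.

Lemma Rint_cst (a : R) : (\int[P]_x a = a)%R.
Proof.
rewrite Rintegral_cst// [X in fine X](_ : _ = 1%E) ?mulr1//.
exact: probability_setT.
Qed.

Lemma Rint_bounded (f : T -> R) (M : R) : measurable_fun setT f ->
  (forall x, `|f x| <= M) -> `|\int[P]_x f x| <= M.
Proof.
by move=> mf fM; rewrite -[leRHS]Rint_cst; apply: Rint_abs_le => //; exact: integ_cst.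
Qed.

(** On a probability space constants are integrable, and [|f| <= 1 + f^2]. *)
Lemma integ_sqr (f : T -> R) : measurable_fun setT f -> integ P (fun x => f x ^+ 2) ->
  integ P f.
Proof.
move=> mf fi; apply: (integ_dom mf _ (integD (integ_cst 1) fi)) => x.
by rewrite -real_normK ?num_real//; nra.
Qed.

End finite_integrable.

(** * Second-order Taylor expansion on the line with a Lipschitz second derivative *)

Section taylor.
Context {R : realType}.

Lemma homo_of_derive_le0 (f f' : R -> R) (a b : R) : a <= b ->
  (forall t : R, is_derive t 1 f (f' t)) ->
  (forall t, t \in `]a, b[ -> f' t <= 0) -> f b <= f a.
Proof.
move=> ab df fle.
apply: (@ler0_derive1_nincr _ f a b) => //.
- by move=> x /fle; rewrite derive1E; have := df x => H; rewrite derive_val.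
- apply: derivable_within_continuous => x _; by case: (df x).
Qed.

(** The bound on [f2] is integrated twice without integrals: each auxiliary [h] subtracts the
    expected polynomial, has a nonpositive derivative on the positive axis, and is compared with its
    value at [0]. *)
Lemma taylor2_le (f f1 f2 : R -> R) (L : R) :
  (forall t : R, is_derive t 1 f (f1 t)) ->
  (forall t : R, is_derive t 1 f1 (f2 t)) ->
  (forall t, 0 <= t -> f2 t - f2 0 <= L * t) ->
  f 1 - f 0 - f1 0 - f2 0 / 2 <= L / 6.
Proof.
move=> d1 d2 fL.
have step (t : R) : 0 <= t -> f1 t - f1 0 - f2 0 * t - L / 2 * t ^+ 2 <= 0.
  move=> t0.
  pose h x := f1 x - f1 0 - f2 0 * x - L / 2 * x ^+ 2.
  have : h t <= h 0.
    apply: (@homo_of_derive_le0 h (fun x => f2 x - f2 0 - L * x)) => //.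
      move=> x; have := d2 x => H; apply: is_derive_eq.
      by rewrite /GRing.scale /=; lra.
    by move=> x /[!in_itv]/= /andP[x0 _]; have := fL x (ltW x0); lra.
  by rewrite /h; lra.
pose h x := f x - f 0 - f1 0 * x - f2 0 / 2 * x ^+ 2 - L / 6 * x ^+ 3.
have : h 1 <= h 0.
  apply: (@homo_of_derive_le0 h (fun x => f1 x - f1 0 - f2 0 * x - L / 2 * x ^+ 2)) =>
    //.
    move=> x; have := d1 x => H; apply: is_derive_eq.
    by rewrite /GRing.scale /=; lra.
  by move=> x /[!in_itv]/= /andP[x0 _]; exact: step (ltW x0).
by rewrite /h; lra.
Qed.

Lemma taylor2 (f f1 f2 : R -> R) (L : R) :
  (forall t : R, is_derive t 1 f (f1 t)) ->
  (forall t : R, is_derive t 1 f1 (f2 t)) ->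
  (forall t, 0 <= t -> `|f2 t - f2 0| <= L * t) ->
  `|f 1 - f 0 - f1 0 - f2 0 / 2| <= L / 6.
Proof.
move=> d1 d2 fL; rewrite ler_norml; apply/andP; split; last first.
  by apply: taylor2_le d1 d2 _ => t /fL; rewrite ler_norml => /andP[].
have : (- f) 1 - (- f) 0 - (- f1) 0 - (- f2) 0 / 2 <= L / 6.
  apply: (taylor2_le (f1 := - f1) (f2 := - f2)) => t /fL.
  by rewrite ler_norml => /andP[+ _]; rewrite !fctE; lra.
by rewrite !fctE; lra.
Qed.

End taylor.

(** * Pulling a known factor out of a conditional expectation *)

Section pull_out.
Context {R : realType} d (T : measurableType d) (P : probability T R).
Context d' (T' : measurableType d').
Variable X : {RV P >-> T'}.

Lemma Rint_indicM (A : set T) (f : T -> R) :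
  (\int[P]_w (\1_A w * f w) = \int[P]_(w in A) f w)%R.
Proof.
rewrite [RHS]Rintegral_mkcond; apply: eq_Rintegral => w _.
by rewrite patchE indicE; case: ifP => _; rewrite ?mul1r ?mul0r.
Qed.

Lemma cond_exp_indic (Y V : T -> R) (B : set T') : is_cond_exp X Y V ->
  measurable B ->
  (\int[P]_w (\1_(X @^-1` B) w * (Y w - V w)) = 0)%R.
Proof.
move=> [iY iV mV YV] mB.
have mXB : measurable (X @^-1` B) by rewrite -[X in measurable X]setTI;
  exact: measurable_funPT.
have iS f : integ P f -> P.-integrable (X @^-1` B) (EFin \o f).
  by apply: integrableS.
rewrite Rint_indicM RintegralB ?iS//; apply/eqP; rewrite subr_eq0; apply/eqP.
rewrite /Rintegral YV//; exists B => //; exact: setTI.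
Qed.

(* [H] is rounded down to multiples of [1/n], which leaves finitely many level
   sets, each of them measurable with respect to [X]. *)
Lemma cond_exp_pull_out (Y V : T -> R) (H : T' -> R) (M : R) : is_cond_exp X Y V ->
  measurable_fun setT H -> (forall x, `|H x| <= M) ->
  (\int[P]_w (H (X w) * Y w) = \int[P]_w (H (X w) * V w))%R.
Proof.
move=> YV mH HM; have [iY iV _ _] := YV.
pose D w := Y w - V w.
have iD : integ P D by exact: integB.
have mHX : measurable_fun setT (H \o X) by exact: measurableT_comp.
have iH f : integ P f -> integ P (fun w => H (X w) * f w).
  by move=> fi; apply: (@integM _ _ _ _ (H \o X) _ M) => // w; exact: HM.
apply/eqP; rewrite -subr_eq0 -RintegralB ?iH//.
have -> : (\int[P]_w (H (X w) * Y w - H (X w) * V w) = \int[P]_w (H (X w) * D w))%R.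
  by apply: eq_Rintegral => w _; rewrite -mulrBr.
rewrite -normr_le0; apply/ler_addgt0Pl => e e0; rewrite addr0.
pose C := (\int[P]_w `|D w|)%R.
have C0 : 0 <= C by apply: Rintegral_ge0.
(* Rounding moves [H] by at most [1 / n], hence the integral by at most [C / n], which this [n]
   makes at most [e]. *)
pose n := (Num.truncn (C / e)).+1.
have n0 : 0 < n%:R :> R by rewrite ltr0n.
have Cn : C / n%:R <= e.
  rewrite ler_pdivrMr// mulrC -ler_pdivrMr//.
  by apply/ltW; rewrite /n; exact: truncnS_gt.
pose N := (Num.truncn (M * n%:R)).+1.
have MN : M * n%:R < N%:R by exact: truncnS_gt.
pose B (i : 'I_(N + N)) : set T' := H @^-1` `[(i%:R - N%:R) / n%:R,
  (i.+1%:R - N%:R) / n%:R[.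
have mB i : measurable (B i) by rewrite -[X in measurable X]setTI; exact: mH.
pose S (w : T) : R := \sum_(i < N + N) (i%:R - N%:R) / n%:R * \1_(X @^-1` B i) w.
have HS w : `|H (X w) - S w| <= n%:R^-1.
  have [h1 h2] : - N%:R < H (X w) * n%:R /\ H (X w) * n%:R < N%:R.
    have : `|H (X w) * n%:R| < N%:R.
      by rewrite normrM (gtr0_norm n0) (le_lt_trans _ MN)// ler_wpM2r// ltW.
    by rewrite ltr_norml => /andP[].
  (* [Num.truncn] is a floor on nonnegative reals only, hence the shift by [N]; the [N + N] levels
     then cover the whole range of [H]. *)
  pose j := Num.truncn (H (X w) * n%:R + N%:R).
  have /andP[j1 j2] : j%:R <= H (X w) * n%:R + N%:R < j.+1%:R.
    by apply: truncn_itv; lra.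
  have jN : (j < N + N)%N.
    rewrite -(ltr_nat R) natrD; lra.
  rewrite /S (bigD1 (Ordinal jN))//= big1 ?addr0; last first.
    move=> i ij; rewrite indicE; case: (boolP (_ \in _)); rewrite ?mulr0//.
    rewrite inE /B /= in_itv /= ler_pdivrMr// ltr_pdivlMr// => /andP[i1 i2].
    case/eqP: ij; apply/val_inj => /=; apply/eqP; rewrite eqn_leq.
    by apply/andP; split; rewrite -ltnS -(ltr_nat R); lra.
  have -> : \1_(X @^-1` B (Ordinal jN)) w = 1 :> R.
    rewrite indicE mem_set// /B /= in_itv /= ler_pdivrMr// ltr_pdivlMr//.
    by apply/andP; split; lra.
  rewrite mulr1.
  have -> : H (X w) - (j%:R - N%:R) / n%:R = (H (X w) * n%:R + N%:R - j%:R) / n%:R.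
    by field; rewrite pnatr_eq0.
  rewrite ger0_norm; last by apply: divr_ge0; rewrite ?subr_ge0// ltW.
  rewrite -[leRHS]div1r; apply: ler_wpM2r; first by rewrite invr_ge0 ltW.
  by move: j2; rewrite -natr1; lra.
have mX1 i : measurable_fun setT (\1_(X @^-1` B i) : T -> R).
  by apply: measurable_indic; rewrite -[X in measurable X]setTI;
    exact: measurable_funPT.
have mS : measurable_fun setT S.
  by apply: measurable_sum => i; apply: measurable_funM.
have ib i : integ P (fun w => \1_(X @^-1` B i) w * D w).
  by apply: (@integM _ _ _ _ _ _ 1) => // x; rewrite indicE; case: (_ \in _);
    rewrite ?normr1 ?normr0.
have SDE w : S w * D w = \sum_(i < N + N) (i%:R - N%:R) / n%:R * (\1_(X @^-1` B i) w *
  D w).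
  by rewrite /S mulr_suml; apply: eq_bigr => i _; rewrite mulrA.
have iSD : integ P (fun w => S w * D w).
  apply: (@integ_ext _ _ _ _ (fun w =>
    \sum_(i < N + N) (i%:R - N%:R) / n%:R * (\1_(X @^-1` B i) w * D w))).
    by move=> w; rewrite SDE.
  by apply: integ_sum => i _; exact: integZ.
have SD0 : (\int[P]_w (S w * D w) = 0)%R.
  under eq_Rintegral do rewrite SDE.
  rewrite Rint_sum; last by move=> i _; exact: integZ.
  by apply: big1 => i _; rewrite RintegralZl// cond_exp_indic// mulr0.
(* The rounded function integrates to [0] against [D], so only the rounding error is left. *)
have -> : (\int[P]_w (H (X w) * D w) = \int[P]_w ((H (X w) - S w) * D w))%R.
  rewrite -[LHS]subr0 -SD0 -RintegralB ?iH//.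
  by apply: eq_Rintegral => w _; rewrite mulrBl.
apply: le_trans Cn; rewrite mulrC -RintegralZl//; last exact: integ_norm.
apply: Rint_abs_le.
- by apply: measurable_funM; [exact: measurable_funB|exact: integ_measurable iD].
- exact/integZ/integ_norm.
- by move=> w; rewrite normrM ler_wpM2r.
Qed.

End pull_out.

(** * The Borel sigma-algebra of row vectors *)

Section borel_rV.
Context {R : realType}.

Lemma measurable_fun_continuous_mx m n (F : 'M[R]_(m, n) -> R) : continuous F ->
  measurable_fun setT (F : borel_mx R m n -> R).
Proof.
move=> cF; apply: (measurability _ (RGenOInfty.measurableE R)) => _ [_ [x ->] <-].
rewrite setTI; apply: sub_sigma_algebra.
by apply: open_comp => [y _|]; [exact: cF|exact: rray_open].
Qed.

Lemma measurable_coord m n (i : 'I_m) (j : 'I_n) :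
  measurable_fun setT (fun x : borel_mx R m n => (x : 'M[R]_(m, n)) i j).
Proof. by apply: measurable_fun_continuous_mx => x; exact: coord_continuous. Qed.

Definition box k (A : 'I_k -> set R) : set 'rV[R]_k := [set x | forall i, A i (x 0 i)].

(** The index type is countable, so unions of such cubes stay measurable. *)
Definition rat_cube k (p : nat * {ffun 'I_k -> rat}) : set 'rV[R]_k :=
  box (fun i => ball (ratr (p.2 i) : R) (p.1.+1%:R^-1)).

Lemma open_rat_cubes k (O : set 'rV[R]_k) : open O ->
  O = \bigcup_(p in [set p | rat_cube p `<=` O]) rat_cube p.
Proof.
move=> oO; apply/seteqP; split; last by move=> x [p /= pO px]; exact: pO.
move=> x Ox; have /nbhs_ballP[e /= e0 xeO] : nbhs x O by exact: open_nbhs_nbhs.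
pose n := Num.truncn (2 / e).
have n0 : 0 < n.+1%:R^-1 :> R by rewrite invr_gt0 ltr0n.
(* The radius is below [e / 2] because the triangle inequality goes from [x] to a point of the cube
   through its center. *)
have ne : n.+1%:R^-1 < e / 2.
  rewrite -[e / 2]invrK ltf_pV2 ?posrE ?invr_gt0 ?divr_gt0// invf_div.
  exact: truncnS_gt.
have /choice[q qP] : forall i : 'I_k, exists q : rat,
  ball (x 0 i) n.+1%:R^-1 (ratr q : R).
  move=> i; have [] := @dense_rat R (ball (x 0 i) n.+1%:R^-1).
  - by exists (x 0 i); exact: ballxx.
  - exact: ball_open.
  - by move=> y [xy [q _ qy]]; exists q; rewrite qy.
exists (n, [ffun i => q i]) => /=.
  move=> y yq; apply: xeO; split => // i j; rewrite (ord1 i).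
  have := yq j; rewrite /= ffunE => h.
  rewrite [e]splitr; apply: (@ball_triangle _ R (ratr (q j) : R)).
    exact: (le_ball (ltW ne)).
  exact: (le_ball (ltW ne)).
by move=> i /=; rewrite ffunE; exact: ball_sym.
Qed.

(** An open set is a countable union of rational cubes, and the preimage of a cube is a finite
    intersection of preimages under coordinates. *)
Lemma measurable_fun_rV d (T : measurableType d) k (Y : T -> borel_mx R 1 k) :
  (forall i, measurable_fun setT (fun w => (Y w : 'rV[R]_k) 0 i)) ->
  measurable_fun setT Y.
Proof.
move=> mY; apply: (@measurability _ _ T (borel_mx R 1 k) setT Y (@open 'rV[R]_k)) =>
  // _ [U oU <-].
rewrite setTI (open_rat_cubes oU) preimage_bigcup bigcup_mkcond.
apply: countable_bigcupT_measurable => [|p].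
  by apply: countableP.
case: ifP => // _.
have -> : Y @^-1` rat_cube p =
    \big[setI/setT]_(i < k) ((fun w =>
      (Y w : 'rV[R]_k) 0 i) @^-1` ball (ratr (p.2 i) : R) (p.1.+1%:R^-1)).
  rewrite -bigcap_seq; apply/seteqP; split => w /=.
    by move=> h i _; exact: h.
  by move=> h i; apply: h; rewrite /= mem_index_enum.
apply: bigsetI_measurable => i _; rewrite -[X in measurable X]setTI.
by apply: mY => //; exact: measurable_ball.
Qed.

Definition boxes k : set (set 'rV[R]_k) :=
  [set B | exists2 A : 'I_k -> set R, (forall i, measurable (A i)) & B = box A].

Lemma measurable_box k (A : 'I_k -> set R) : (forall i, measurable (A i)) ->
  measurable (box A : set (borel_mx R 1 k)).
Proof.
move=> mA.
have -> : box A = \big[setI/setT]_(i < k) ((fun x : borel_mx R 1 k =>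
  (x : 'rV[R]_k) 0 i) @^-1` A i).
  rewrite -bigcap_seq; apply/seteqP; split => w /=.
    by move=> h i _; exact: h.
  by move=> h i; apply: h; rewrite /= mem_index_enum.
apply: bigsetI_measurable => i _; rewrite -[X in measurable X]setTI.
by apply: measurable_coord => //; exact: measurable_ball.
Qed.

Lemma borel_rV_boxes k : @measurable _ (borel_mx R 1 k) = <<s @boxes k >>.
Proof.
apply/seteqP; split; last first.
  apply: smallest_sub; first exact: sigma_algebra_measurable.
  by move=> _ [A mA ->]; exact: measurable_box.
(* The identity, from the sigma-algebra of boxes to the Borel one, has measurable coordinates, so
   every Borel set belongs to the former. *)
have mid : measurable_fun setT (fun x : g_sigma_algebraType (@boxes k) =>
  (x : borel_mx R 1 k)).
  apply: measurable_fun_rV => i _ B mB; rewrite setTI; apply: sub_sigma_algebra.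
  exists (fun j => if j == i then B else setT).
    by move=> j; case: ifP.
  apply/seteqP; split=> x /=; first by move=> Bx j; case: eqP => // ->.
  by move=> /(_ i); rewrite eqxx.
by move=> A mA; have := mid measurableT A mA; rewrite setTI.
Qed.

Lemma setI_closed_boxes k : setI_closed (@boxes k).
Proof.
move=> _ _ [A mA ->] [B mB ->]; exists (fun i => A i `&` B i).
  by move=> i; exact: measurableI.
apply/seteqP; split=> x; first by move=> [Ax Bx] i; split.
by move=> ABx; split=> i; have [] := ABx i.
Qed.

(** Boxes form a generating pi-system. This is how a law known through independent coordinates is
    identified. *)
Lemma eq_measure_boxes k (m1 m2 : {measure set (borel_mx R 1 k) -> \bar R}) :
  (m1 setT < +oo)%E ->
  (forall A : 'I_k -> set R, (forall i, measurable (A i)) -> m1 (box A) = m2 (box A)) ->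
  forall B, measurable B -> m1 B = m2 B.
Proof.
move=> m1fin m12 B mB.
have boxT : box (fun=> setT) = [set: 'rV[R]_k] by apply/seteqP; split.
apply: (@measure_unique _ R (borel_mx R 1 k) (@boxes k) (fun=> setT)) => //.
- exact: borel_rV_boxes.
- exact: setI_closed_boxes.
- by move=> _; exists (fun=> setT).
- by rewrite bigcup_const.
- by move=> _ [A mA ->]; exact: m12.
Qed.

End borel_rV.

(** * The standard normal law on the line *)

Section gauss1.
Context {R : realType}.
Notation leb := (@lebesgue_measure R).
Notation N01 := (normal_prob (0 : R) 1).
Notation pdf := (normal_pdf (0 : R) 1).

(** Change of variables speaks of the Radon-Nikodym derivative, which is obtained by choice; this
    identifies it with the explicit density. *)
Lemma normal_prob_density : ae_eq leb setT
  (Radon_Nikodym (charge_of_finite_measure N01) leb) (EFin \o pdf).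
Proof.
have dom := normal_prob_dominates (0 : R) 1.
rewrite Radon_NikodymE//=; case: cid => /= h [h1 h2 h3].
apply: integral_ae_eq => //=.
- by apply/measurable_EFinP; exact: measurable_normal_pdf.
- by move=> E E01 mE; rewrite -h3.
Qed.

(** Kept apart from the signed version because integrability with respect to [N01] is itself deduced
    from it. *)
Lemma ge0_integral_normal_prob (f : R -> R) : measurable_fun setT f ->
  (forall x, 0 <= f x) ->
  (\int[N01]_x (f x)%:E = \int[leb]_x (f x * pdf x)%:E)%E.
Proof.
move=> mf f0; have dom := normal_prob_dominates (0 : R) 1.
rewrite -(Radon_Nikodym_SigmaFinite.change_of_variables dom)//;
  last exact/measurable_EFinP.
apply: ae_eq_integral => //.
- by apply: emeasurable_funM; [exact/measurable_EFinP|
    exact: measurable_int (Radon_Nikodym_SigmaFinite.f_integrable dom)].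
- by apply/measurable_EFinP; apply: measurable_funM => //; exact: measurable_normal_pdf.
- have A1 := ae_eq_Radon_Nikodym_SigmaFinite dom measurableT.
  by apply: filterS2 A1 normal_prob_density => x /= E1 E2 _; rewrite E1// E2.
Qed.

Lemma integ_normal_prob (f : R -> R) : measurable_fun setT f ->
  integ leb (fun x => f x * pdf x) -> integ N01 f.
Proof.
move=> mf /integrableP[mfp fp]; apply/integrableP; split; first exact/measurable_EFinP.
rewrite (_ : (fun x : R => `|(EFin \o f) x|%E) = (fun x => (`|f x|)%:E))//.
rewrite ge0_integral_normal_prob//; last exact: measurableT_comp.
apply: le_lt_trans fp; apply: ge0_le_integral => //.
- by move=> x _; rewrite lee_fin mulr_ge0// normal_pdf_ge0.
- by apply/measurable_EFinP/measurable_funM;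
  [exact: measurableT_comp|exact: measurable_normal_pdf].
- exact: measurableT_comp.
- by move=> x _ /=; rewrite lee_fin normrM (ger0_norm (normal_pdf_ge0 _ _ _)).
Qed.

Lemma Rint_normal_prob (f : R -> R) : measurable_fun setT f -> integ N01 f ->
  (\int[N01]_x f x = \int[leb]_x (f x * pdf x))%R.
Proof.
move=> mf fi; have dom := normal_prob_dominates (0 : R) 1.
rewrite /Rintegral -(Radon_Nikodym_change_of_variables dom)//; congr fine.
apply: ae_eq_integral => //.
- by apply: emeasurable_funM; [exact/measurable_EFinP|
    by apply: (measurable_int leb); exact: Radon_Nikodym_integrable].
- by apply/measurable_EFinP; apply: measurable_funM => //; exact: measurable_normal_pdf.
- exact: ae_eqe_mul2l normal_prob_density.
Qed.

Lemma normal_pdf01E x : pdf x = normal_peak 1 * expR (- x ^+ 2 / 2).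
Proof.
by rewrite normal_pdfE ?oner_eq0// /normal_fun subr0 expr1n.
Qed.

(* [x^2 exp(-3x^2/8) <= 8/3], and the remaining factor [exp(-x^2/8)] is the
   density with standard deviation [2] up to a constant. *)
Lemma sqr_normal_pdf_le x : x ^+ 2 * pdf x <= 8 * normal_pdf (0 : R) 2 x.
Proof.
rewrite normal_pdf01E normal_pdfE ?pnatr_eq0// /normal_fun subr0.
have h2 : 0 <= normal_peak (2 : R) by exact: normal_peak_ge0.
have pk : normal_peak (1 : R) = 2 * normal_peak 2.
  rewrite /normal_peak expr1n mul1r (_ : 2 ^+ 2 * pi *+ 2 = 2 ^+ 2 * (pi *+ 2) :> R);
    last first.
    by ring.
  rewrite sqrtrM ?sqr_ge0// sqrtr_sqr ger0_norm// invfM mulrA divff ?mul1r//.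
rewrite pk.
have -> : - x ^+ 2 / 2 = - x ^+ 2 / (2 ^+ 2 *+ 2) + - (x ^+ 2 * (3 / 8)).
  by rewrite (_ : 2 ^+ 2 *+ 2 = 8 :> R); [field|rewrite expr2; lra].
rewrite expRD; set e := expR (_ / (_ *+ _)).
have e0 : 0 <= e by exact: expR_ge0.
(* The two peaks differ by a factor [2], so the [8] of the statement leaves [4] here. *)
suff H : x ^+ 2 * expR (- (x ^+ 2 * (3 / 8))) <= 4.
  have := ler_wpM2l (mulr_ge0 h2 e0) H; lra.
have y0 : 0 <= x ^+ 2 by exact: sqr_ge0.
rewrite expRN -ler_pdivlMr ?invr_gt0 ?expR_gt0// invrK.
have := expR_ge1Dx (x ^+ 2 * (3 / 8)); lra.
Qed.

Lemma integ_sqr_pdf : integ leb (fun x => x ^+ 2 * pdf x).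
Proof.
apply: (@integ_dom R _ (measurableTypeR R) leb _ (fun x => 8 * normal_pdf (0 : R) 2 x)).
- by apply: measurable_funM; [exact: measurable_funX|exact: measurable_normal_pdf].
- move=> x; rewrite ger0_norm ?sqr_normal_pdf_le// mulr_ge0 ?sqr_ge0//.
  exact: normal_pdf_ge0.
- by apply: integZ; exact: integrable_normal_pdf.
Qed.

Lemma integ_normal_sqr : integ N01 (fun x => x ^+ 2).
Proof. by apply: integ_normal_prob; [exact: measurable_funX|exact: integ_sqr_pdf]. Qed.

Lemma integ_normal_id : integ N01 (fun x => x).
Proof. by apply: integ_sqr integ_normal_sqr. Qed.

Lemma is_derive_normal_pdf (x : R) : is_derive x 1 pdf (- (x * pdf x)).
Proof.
rewrite (_ : pdf = fun y => normal_peak 1 * expR (- y ^+ 2 / 2)); last first.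
  by apply/funext => y; rewrite normal_pdf01E.
by apply: is_derive_eq; rewrite /GRing.scale /=; field.
Qed.

End gauss1.

(** * Gaussian integration by parts on the line and the first absolute moment *)

Section gauss1_IBP.
Context {R : realType}.
Notation leb := (@lebesgue_measure R).
Notation N01 := (normal_prob (0 : R) 1).
Notation pdf := (normal_pdf (0 : R) 1).

(** The integral of [F'] over a symmetric interval is a difference of end values that tends to [0],
    and it tends to the full integral by dominated convergence. *)
Lemma Rint_derive_eq0 (F F' : R -> R) :
  (forall t : R, is_derive t 1 F (F' t)) -> continuous F' -> integ leb F' ->
  F n%:R @[n --> \oo] --> 0 -> F (- n%:R) @[n --> \oo] --> 0 ->
  (\int[leb]_t F' t = 0)%R.
Proof.
move=> dF cF' iF' F1 F2.
have cF : continuous F.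
  by move=> x; apply/differentiable_continuous/derivable1_diffP; case: (dF x).
(* With [n.+1] the interval is never reduced to a point, as the fundamental theorem of calculus
   requires. *)
pose f_ (n : nat) (t : R) : \bar R := (\1_(`[- n.+1%:R, n.+1%:R] : set R) t * F' t)%:E.
have mF' := integ_measurable iF'.
have E n : (\int[leb]_t f_ n t = (F n.+1%:R - F (- n.+1%:R))%:E)%E.
  have <- : (\int[leb]_(t in `[(- n.+1%:R)%R,
    n.+1%:R]) (F' t)%:E = (F n.+1%:R - F (- n.+1%:R))%:E)%E.
    rewrite (@continuous_FTC2 _ F' F) ?EFinB//.
    - have : 0 < n.+1%:R :> R by rewrite ltr0n.
      lra.
    - exact: continuous_subspaceT.
    - split.
      + by move=> x _; case: (dF x).
      + exact/cvg_at_right_filter/cF.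
      + exact/cvg_at_left_filter/cF.
    - by move=> x _; rewrite derive1E; have := dF x => H; rewrite derive_val.
  rewrite [RHS]integral_mkcond; apply: eq_integral => t _.
  by rewrite /f_ patchE indicE; case: ifP => _; rewrite ?mul1r ?mul0r.
have cvf : (\int[leb]_t f_ n t @[n --> \oo] --> \int[leb]_t (F' t)%:E)%E.
  apply: (@dominated_cvg _ _ _ leb setT measurableT f_ _ (fun t => `|F' t|%:E)) => //.
  - by move=> n; apply/measurable_EFinP/measurable_funM => //; exact: measurable_indic.
  - move=> t _; apply: cvg_near_cst; near=> n.
    rewrite /f_ indicE mem_set ?mul1r//= in_itv /= -ler_norml.
    near: n; exists (Num.truncn `|t|) => //= n /= tn.
    apply/ltW/(lt_le_trans (truncnS_gt _)); by rewrite ler_nat.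
  - exact: integ_norm.
  - move=> n t _; rewrite /f_ /= lee_fin normrM ler_piMl// indicE.
    by case: (_ \in _); rewrite ?normr1 ?normr0.
have : (\int[leb]_t f_ n t @[n --> \oo] --> 0%:E)%E.
  under eq_fun do rewrite E.
  apply: cvg_EFin; first exact: nearW.
  rewrite -[X in _ --> X](subr0 (0:R)); apply: cvgB.
    by have := F1; rewrite -(cvg_shiftS (fun n => F n%:R)).
  by have := F2; rewrite -(cvg_shiftS (fun n => F (- n%:R))).
move=> cv0; have E0 := cvg_unique (@ereal_hausdorff R) cvf cv0.
by rewrite /Rintegral E0.
Unshelve. all: end_near. Qed.

(** The derivative of [f * pdf] is [(f' - t f) * pdf], and [f * pdf] vanishes at both ends because
    [f] grows at most linearly. Integrability of [t * f t] follows from the same growth bound. *)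
Lemma normal_IBP (f f' : R -> R) (b : R) :
  (forall t : R, is_derive t 1 f (f' t)) -> continuous f' ->
  (forall t, `|f' t| <= b) ->
  integ N01 (fun t => t * f t) /\
  (\int[N01]_t (t * f t) = \int[N01]_t f' t)%R.
Proof.
move=> df cf' fb.
have cf : continuous f.
  by move=> x; apply/differentiable_continuous/derivable1_diffP; case: (df x).
have mf : measurable_fun setT f by exact: continuous_measurable_fun.
have mf' : measurable_fun setT f' by exact: continuous_measurable_fun.
have b0 : 0 <= b by apply: le_trans (fb 0).
have fub t : `|f t| <= `|f 0| + b * `|t|.
  have [|t0|<-] := ltrgtP 0 t; last by rewrite normr0 mulr0 addr0.
  - move=> t0; have [c _ E] := @MVT R f f' 0 t t0 (fun x _ =>
    df x) (continuous_subspaceT cf).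
    have -> : f t = f 0 + f' c * (t - 0) by rewrite -E; ring.
    rewrite subr0 (le_trans (ler_normD _ _))// lerD2l normrM.
    by apply: ler_wpM2r.
  - have [c _ E] := @MVT R f f' t 0 t0 (fun x _ => df x) (continuous_subspaceT cf).
    have -> : f t = f 0 + f' c * (t - 0) by rewrite -[f 0](subrK (f t)) E; ring.
    rewrite subr0 (le_trans (ler_normD _ _))// lerD2l normrM.
    by apply: ler_wpM2r.
have i1 : integ N01 f'.
  exact: (@integ_bounded R _ (measurableTypeR R) N01 f' b).
have i2 : integ N01 (fun t => t * f t).
  apply: (@integ_dom R _ (measurableTypeR R) N01 _ (fun t =>
    `|f 0| * `|t| + b * t ^+ 2)).
  - exact: measurable_funM.
  - move=> t; rewrite normrM (le_trans (ler_wpM2l _ (fub t)))// mulrDr -(real_normK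
    (num_real t)) expr2.
    by rewrite mulrC lerD2l mulrCA.
  - apply: integD; first exact/integZ/integ_norm/integ_normal_id.
    exact/integZ/integ_normal_sqr.
split; first exact: i2.
apply/esym/eqP; rewrite -subr_eq0 -RintegralB//; apply/eqP.
have i3 : integ N01 (fun t => f' t - t * f t) by exact: integB.
have m3 := integ_measurable i3.
have cpdf : continuous pdf by exact: continuous_normal_pdf.
rewrite Rint_normal_prob//.
(* The sign [s] treats both ends at once. As [f] is of order [n] there and the density of order
   [1 / n^2], the product is at most [K / n]. *)
have tl (s : R) : `|s| = 1 -> f (s * n%:R) * pdf (s * n%:R) @[n --> \oo] --> 0.
  move=> s1; pose K := (`|f 0| + b) * (8 * normal_peak 2).
  apply/cvgr0Pnorm_le => e e0; near=> n.
  have n1 : 1 <= n%:R :> R by rewrite ler1n; near: n; exists 1%N.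
  have n0 : 0 < n%:R :> R by lra.
  have pn : n%:R ^+ 2 * pdf (s * n%:R) <= 8 * normal_peak 2.
    have := sqr_normal_pdf_le (s * n%:R).
    rewrite -[X in X * _]real_normK ?num_real// normrM s1 mul1r (gtr0_norm n0).
    move=> /le_trans; apply; rewrite ler_pM2l//.
    by apply: normal_pdf_ub; rewrite pnatr_eq0.
  have fn : `|f (s * n%:R)| <= (`|f 0| + b) * n%:R.
    apply: le_trans (fub _) _; rewrite normrM s1 mul1r (gtr0_norm n0).
    have := normr_ge0 (f 0); nra.
  have p0 := normal_pdf_ge0 (0:R) 1 (s * n%:R).
  rewrite normrM (ger0_norm p0).
  have h1 : `|f (s * n%:R)| * pdf (s * n%:R) <= (`|f 0| + b) * n%:R * pdf (s * n%:R).
    exact: ler_wpM2r.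
  apply: le_trans h1 _.
  have : (`|f 0| + b) * n%:R * pdf (s * n%:R) * n%:R <= K.
    rewrite /K (_ : _ * n%:R * _ * _ = (`|f 0| + b) * (n%:R ^+ 2 * pdf (s * n%:R)));
      last by ring.
    by apply: ler_wpM2l => //; exact: addr_ge0.
  rewrite -ler_pdivlMr// => /le_trans; apply.
  rewrite ler_pdivrMr// mulrC -ler_pdivrMr//.
  near: n; exists (Num.truncn (K / e)).+1 => //= n /= Kn.
  apply/ltW/(lt_le_trans (truncnS_gt _)); by rewrite ler_nat.
apply: (@Rint_derive_eq0 (fun t => f t * pdf t)).
- move=> t; have := df t => H1; have := is_derive_normal_pdf t => H2.
  by apply: is_derive_eq; rewrite /GRing.scale /=; ring.
- move=> t; apply: cvgM; last exact: cpdf.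
  apply: cvgB; first exact: cf'.
  by apply: cvgM; [exact: cvg_id|exact: cf].
- have mp : measurable_fun setT pdf by exact: measurable_normal_pdf.
  (* With [a = |f 0|], the growth bound gives [|f' - t f| <= b + a |t| + b t^2], which is at most
     [(a + b) (1 + t^2)]. *)
  apply: (@integ_dom R _ (measurableTypeR R) leb _
    (fun t => (b + `|f 0|) * pdf t + (b + `|f 0|) * (t ^+ 2 * pdf t))).
  + exact: measurable_funM.
  + move=> t; have p0 := normal_pdf_ge0 (0:R) 1 t.
    rewrite normrM (ger0_norm p0) mulrA -mulrDl; apply: ler_wpM2r => //.
    apply: le_trans (ler_normB _ _) _; rewrite normrM.
    have := fb t; have := ler_wpM2l (normr_ge0 t) (fub t).
    have := normr_ge0 (f 0); rewrite -[t ^+ 2]real_normK ?num_real//.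
    set u := `|t|; set a := `|f 0| => a0 h1 h2.
    have := mulr_ge0 a0 (sqr_ge0 (u - 1)); have := mulr_ge0 a0 (sqr_ge0 u); nra.
  + apply: integD; first by apply: integZ; exact: integrable_normal_pdf.
    exact/integZ/integ_sqr_pdf.
- have := tl 1 (normr1 _); under eq_fun do rewrite mul1r; exact.
- have := tl (-1) (normrN1 _); under eq_fun do rewrite mulN1r; exact.
Unshelve. all: end_near. Qed.

(** Twice the integral over the positive axis, where [t * pdf t] has the primitive [- pdf]. The
    value is [sqrt(2 / pi)]. *)
Lemma Rint_normal_abs : (\int[N01]_t `|t| = 2 * normal_peak 1)%R.
Proof.
have cpdf : continuous pdf by exact: continuous_normal_pdf.
have pge := normal_pdf_ge0 (0:R) 1.
rewrite /Rintegral ge0_integral_normal_prob//.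
rewrite (@ge0_symfun_integralT R (fun t => `|t| * pdf t)).
- rewrite -set_itvcy (@ge0_continuous_FTC2y R _ (fun t => - pdf t) 0 0).
  + by rewrite sub0e -EFinN -EFinM opprK /= normal_pdf01E expr0n /= oppr0 mul0r expR0
    mulr1.
  + by move=> x _; rewrite mulr_ge0.
  + apply: continuous_subspaceT => t; apply: cvgM; last exact: cpdf.
    exact: norm_continuous.
  + suff c0 : pdf t @[t --> +oo] --> 0 by have := cvgN c0; rewrite oppr0; exact.
    rewrite (_ : normal_pdf 0 1 = fun y : R => normal_peak 1 * expR (- (y ^+ 2 / 2)));
      last first.
      by apply/funext => y; rewrite normal_pdf01E mulNr.
    have <- : normal_peak 1 * 0 = 0 :> R by rewrite mulr0.
    apply: cvgMl_tmp.
    apply: (cvg_comp (fun x : R => x ^+ 2 / 2) (fun y => expR (- y)));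
      last exact: cvgr_expR.
    by apply: gt0_cvgMly; [rewrite invr_gt0|exact: cvgr_expr2].
  + by move=> x _; have := is_derive_normal_pdf x => H; exact: ex_derive.
  + apply: cvgN; exact/cvg_at_right_filter/cpdf.
  + move=> x /[!in_itv]/= /andP[x0 _]; rewrite derive1E;
    have := is_derive_normal_pdf x => H.
    by rewrite derive_val opprK (gtr0_norm x0).
- by move=> x; rewrite mulr_ge0.
- move=> t; apply: cvgM; last exact: cpdf.
  exact: norm_continuous.
- by move=> t /=; rewrite normrN !normal_pdf01E sqrrN.
Qed.

End gauss1_IBP.

(** * Standard Gaussian vectors *)

Section gaussian_vector.
Context {R : realType} {k : nat}.
Context d (T : measurableType d) (Q : probability T R).
Variable Z : {RV Q >-> borel_mx R 1 k}.
Hypothesis hZ : standard_gaussian Z.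
Notation N01 := (normal_prob (0 : R) 1).
Notation z i := (fun w => (Z w : 'rV[R]_k) 0 i).

(** In this affine form the curve in [t] is a line in a coordinate direction. *)
Definition upd (i : 'I_k) (t : R) (x : 'rV[R]_k) : 'rV[R]_k :=
  x + (t - x 0 i) *: delta_mx 0 i.

Lemma updE i t x j : upd i t x 0 j = if j == i then t else x 0 j.
Proof.
rewrite /upd !mxE eqxx /=; case: eqP => [->|_]; last by rewrite mulr0 addr0.
by rewrite mulr1 addrC subrK.
Qed.

Lemma continuous_upd i x : continuous (fun t => upd i t x).
Proof.
move=> t; apply: cvgD; first exact: cvg_cst.
apply: cvgZr_tmp; apply: cvgB; [exact: cvg_id|exact: cvg_cst].
Qed.

Lemma measurable_coordZ i : measurable_fun setT (z i).
Proof.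
exact: (measurableT_comp (measurable_coord (R := R) 0 i) (measurable_funPT Z)).
Qed.

Lemma measurable_continuousZ (F : 'rV[R]_k -> R) : continuous F ->
  measurable_fun setT (fun w => F (Z w)).
Proof.
by move=> /measurable_fun_continuous_mx mF;
  exact: measurableT_comp mF (measurable_funPT Z).
Qed.

Lemma gaussian_box (A : 'I_k -> set R) : (forall i, measurable (A i)) ->
  distribution Q Z (box A) = (\prod_(i < k) N01 (A i))%E.
Proof.
move=> mA; have [ind marg] := hZ.
have := ind [set: 'I_k]%SET A mA; rewrite (_ : \bigcap_(i in _) _ = Z @^-1` box A);
  last first.
  apply/seteqP; split => w /=; first by move=> h i; apply: h; rewrite /= inE.
  by move=> h i _; exact: h.
rewrite /distribution /pushforward => ->.
rewrite (eq_bigl xpredT); last by move=> i; rewrite inE.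
by apply: eq_bigr => i _; rewrite marg.
Qed.

(* Redrawing one coordinate from [N01] does not change the law of [Z]; this
   reduces integration by parts to the one-dimensional case. *)
Definition resample (i : 'I_k) (p : R * borel_mx R 1 k) : borel_mx R 1 k := upd i p.1
  p.2.

Lemma measurable_resample i : measurable_fun setT (resample i).
Proof.
apply: measurable_fun_rV => j; rewrite /resample.
have -> : (fun w : R * borel_mx R 1 k => (upd i w.1 w.2 : 'rV_k) 0 j) =
    if j == i then fst else (fun w => (w.2 : 'rV_k) 0 j).
  by apply/funext => w; rewrite updE; case: ifP.
case: ifP => _; first exact: measurable_fst.
exact: (measurableT_comp (measurable_coord (R := R) 0 j) measurable_snd).
Qed.

Let nu := distribution Q Z.
Let m12 := (N01 \x nu)%E.

(** The preimage of a box is a product set: side [i] constrains the redrawn value alone, the other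
    sides constrain the old vector alone. *)
Lemma resample_box i (A : 'I_k -> set R) : (forall j, measurable (A j)) ->
  m12 (resample i @^-1` box A) = nu (box A).
Proof.
move=> mA.
pose B j := if j == i then setT else A j.
have mB j : measurable (B j) by rewrite /B; case: ifP.
have -> : resample i @^-1` box A = A i `*` (box B : set (borel_mx R 1 k)).
  apply/seteqP; split => -[t x] /=.
    move=> h; split; first by have := h i; rewrite /resample updE eqxx.
    by move=> j; rewrite /B; case: eqP => // /eqP ji; have := h j;
      rewrite /resample updE (negbTE ji).
  move=> [Ai Bx] j; rewrite /resample updE /=; case: eqP => [->//|/eqP ji].
  by have := Bx j; rewrite /B (negbTE ji).
transitivity (N01 (A i) * distribution Q Z (box B))%E.
  by rewrite /m12 product_measure1E//; [exact: mA|exact: measurable_box].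
rewrite /nu !gaussian_box// (bigD1 i)//= [RHS](bigD1 i)//= /B eqxx.
rewrite (_ : N01 setT = 1%E) ?mul1e; last exact: probability_setT.
by congr (_ * _)%E; apply: eq_bigr => j /negbTE ->.
Qed.

(** The image of [m12] under [resample i] agrees with the law of [Z] on boxes, hence everywhere;
    Fubini then puts the redrawn coordinate in the inner integral. *)
Lemma resample_integral i (F : 'rV[R]_k -> R) :
  measurable_fun setT (F : borel_mx R 1 k -> R) -> integ Q (fun w => F (Z w)) ->
  (\int[Q]_w (F (Z w))%:E = \int[nu]_x \int[N01]_t (F (upd i t x))%:E)%E.
Proof.
move=> mF iF.
have mFE : measurable_fun setT (EFin \o (F : borel_mx R 1 k -> R)) by
  exact/measurable_EFinP.
have mr := measurable_resample i.
pose m' := pushforward m12 (resample i).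
have E B : measurable B -> nu B = pushforward m12 (resample i) B.
  move=> mB; apply: eq_measure_boxes => //=.
    by rewrite -ge0_fin_numE// fin_num_measure.
  by move=> A mA; exact/esym/resample_box.
have iN : nu.-integrable setT (EFin \o F).
  by apply: integrable_pushforward => //.
have E1 : (\int[Q]_w (F (Z w))%:E = \int[nu]_x (F x)%:E)%E.
  by rewrite integral_pushforward.
rewrite E1.
have -> : (\int[nu]_x (F x)%:E = \int[pushforward m12 (resample i)]_x (F x)%:E)%E.
  by apply: eq_measure_integral => B mB _; exact: E.
have irho : m12.-integrable setT (EFin \o F \o resample i).
  apply/integrableP; split; first exact: measurableT_comp.
  have -> : (\int[m12]_p `|(EFin \o F \o resample i) p| = \int[pushforward m12
    (resample i)]_x `|(F x)%:E|)%E.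
    by rewrite ge0_integral_pushforward//; exact: measurableT_comp.
  have -> : (\int[pushforward m12 (resample i)]_x `|(F x)%:E| = \int[nu]_x `|(F
    x)%:E|)%E.
    by apply: eq_measure_integral => B mB _; exact/esym/E.
  by have /integrableP[] := iN.
rewrite integral_pushforward//.
rewrite -(integral21_prod_meas1 irho).
by apply: eq_integral => x _.
Qed.

(** After resampling, the inner integral freezes all coordinates but [i], so [normal_IBP] applies to
    it. *)
Lemma gauss_IBP i (F F' : 'rV[R]_k -> R) (b : R) :
  continuous F -> continuous F' ->
  (forall x (t : R), is_derive t 1 (fun t => F (upd i t x)) (F' (upd i t x))) ->
  (forall x, `|F' x| <= b) -> integ Q (fun w => z i w * F (Z w)) ->
  (\int[Q]_w (z i w * F (Z w)) = \int[Q]_w F' (Z w))%R.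
Proof.
move=> cF cF' dF F'b iF.
have mF' : measurable_fun setT (F' : borel_mx R 1 k -> R) by exact:
  measurable_fun_continuous_mx.
have mF : measurable_fun setT ((fun x => x 0 i * F x) : borel_mx R 1 k -> R).
  by apply: measurable_funM; [exact: measurable_coord|exact:
    measurable_fun_continuous_mx].
have iF' : integ Q (fun w => F' (Z w)).
  by apply: integ_bounded => [|w]; [exact: measurable_continuousZ|exact: F'b].
rewrite /Rintegral (@resample_integral i F')// (@resample_integral i (fun x =>
  x 0 i * F x))//.
congr fine; apply: eq_integral => x _.
under eq_integral do rewrite updE eqxx.
have [||i1 E] := @normal_IBP R (fun t => F (upd i t x)) (fun t =>
  F' (upd i t x)) b (dF x).
- move=> t; apply: (cvg_comp (upd i ^~ x) F'); last exact: cF'.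
  exact: continuous_upd.
- by move=> t; exact: F'b.
- have i2 : integ N01 (fun t => F' (upd i t x)).
    apply: (@integ_bounded R _ (measurableTypeR R) N01 _ b) => //.
    apply: continuous_measurable_fun => t.
    apply: (cvg_comp (upd i ^~ x) F'); last exact: cF'.
    exact: continuous_upd.
  rewrite -[LHS]fineK ?integrable_fin_num// -[RHS]fineK ?integrable_fin_num//.
  by congr EFin.
Qed.

Lemma integral_coordZ i (f : R -> R) : measurable_fun setT f -> (forall x, 0 <= f x) ->
  (\int[Q]_w (f (z i w))%:E = \int[N01]_t (f t)%:E)%E.
Proof.
move=> mf f0.
pose zi : T -> measurableTypeR R := z i.
have mz : measurable_fun setT zi by exact: measurable_coordZ.
have E B : measurable B -> N01 B = pushforward Q zi B.
  by move=> mB; rewrite /pushforward (hZ.2 i B mB).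
have -> : (\int[N01]_t (f t)%:E = \int[pushforward Q zi]_t (f t)%:E)%E.
  by apply: eq_measure_integral => B mB _; exact: E.
by rewrite ge0_integral_pushforward//; [exact/measurable_EFinP|move=> y _;
  rewrite lee_fin].
Qed.

Lemma integ_sqrZ i : integ Q (fun w => z i w ^+ 2).
Proof.
apply/integrableP; split; first by
  apply/measurable_EFinP/measurable_funX/measurable_coordZ.
have /integrableP[_] := @integ_normal_sqr R.
have A (f : R -> R) : (fun x => `|(EFin \o f) x|%E) = (fun x => (`|f x|)%:E) by [].
rewrite -(@integral_coordZ i (fun x => `|x ^+ 2|))//.
by apply: measurableT_comp => //; exact: measurable_funX.
Qed.

Lemma integ_Z i : integ Q (z i).
Proof. by apply: integ_sqr (integ_sqrZ i); exact: measurable_coordZ. Qed.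

Lemma integ_ZZ i j : integ Q (fun w => z i w * z j w).
Proof.
have mz := measurable_coordZ.
apply: (integ_dom _ _ (integD (integ_sqrZ i) (integ_sqrZ j))).
  exact: measurable_funM.
move=> w; rewrite normrM -(real_normK (num_real (z i w))) -(real_normK (num_real (z j
  w))).
have := normr_ge0 (z i w); have := normr_ge0 (z j w).
set a := `|z i w|; set b := `|z j w|; have := sqr_ge0 (a - b); nra.
Qed.

(** Integration by parts against the function [x 0 j], whose derivative in coordinate [i] is
    constant, gives the covariances without computing with products of independent variables. *)
Lemma Rint_ZZ i j : (\int[Q]_w (z i w * z j w) = (i == j)%:R)%R.
Proof.
rewrite -[RHS](@Rint_cst _ _ _ Q).
apply: (@gauss_IBP i (fun x => x 0 j) (fun=> (i == j)%:R) 1).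
- by move=> x; exact: coord_continuous.
- by move=> x; exact: cst_continuous.
- move=> x t; under [fun t => _]eq_fun do rewrite updE.
  by case: eqP => [->|/eqP]; [rewrite eqxx; exact: is_derive_id|
    rewrite eq_sym => /negbTE ->; exact: is_derive_cst].
- by move=> x; case: (i == j); rewrite ?normr1 ?normr0.
- exact: integ_ZZ.
Qed.

Lemma Rint_absZ i : (\int[Q]_w `|z i w| = 2 * normal_peak 1)%R.
Proof. by rewrite -Rint_normal_abs /Rintegral (@integral_coordZ i (fun t => `|t|)). Qed.

End gaussian_vector.

(** * Functions of class C1 and the Euclidean norm *)

Section vectors.
Context {R : realType} {k : nat}.

(** Linear in its last argument, so that [dotv (gradient F x)] can serve as the differential of [F]
    at [x]. *)
Definition dotv (c h : 'rV[R]_k) : R := \sum_(i < k) h 0 i * c 0 i.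

Fact dotv_linear (c : 'rV[R]_k) : linear (dotv c : 'rV[R]_k -> R^o).
Proof.
move=> a x y; rewrite /dotv scaler_sumr -big_split /=; apply: eq_bigr => i _.
by rewrite !mxE mulrDl /GRing.scale /= mulrA.
Qed.

HB.instance Definition _ c := GRing.isLinear.Build R 'rV[R]_k R^o _ (dotv c)
  (dotv_linear c).

Lemma dotv_continuous (c : 'rV[R]_k) : continuous (dotv c).
Proof.
apply: continuous_big => [|i _ x]; first exact: add_continuous.
by apply: continuousM; [exact: coord_continuous|exact: cst_continuous].
Qed.

Lemma dotvC (x y : 'rV[R]_k) : dotv x y = dotv y x.
Proof. by apply: eq_bigr => i _; rewrite mulrC. Qed.

Lemma normr_coord_le (x : 'rV[R]_k) i : `|x 0 i| <= `|x|.
Proof.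
by rewrite [in leRHS]/Num.norm/= mx_normrE (le_bigmax _ (fun ij =>
  `|x ij.1 ij.2|) (0, i)).
Qed.

(** The coordinates of an increment have any sign or vanish, and only the size of the intermediate
    point matters. *)
Lemma MVT_at0 (f f' : R -> R) (a : R) : (forall t : R, is_derive t 1 f (f' t)) ->
  exists2 c, `|c| <= `|a| & f a - f 0 = a * f' c.
Proof.
move=> df; have cf : continuous f.
  by move=> t; apply/differentiable_continuous/derivable1_diffP; case: (df t).
have [a0|a0|<-] := ltrgtP 0 a.
- have [c /[!in_itv]/= /andP[c0 ca] E] := @MVT R f f' 0 a a0 (fun t _ =>
  df t) (continuous_subspaceT cf).
  exists c; last by rewrite E subr0 mulrC.
  by rewrite !gtr0_norm ?ltW.
- have [c /[!in_itv]/= /andP[c0 ca] E] := @MVT R f f' a 0 a0 (fun t _ =>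
  df t) (continuous_subspaceT cf).
  exists c; last by rewrite -[LHS]opprB E; ring.
  by rewrite !ltr0_norm // lerN2 ltW.
- by exists 0; rewrite // mul0r subrr.
Qed.

Lemma is_derive_line (F : 'rV[R]_k -> R) (y v : 'rV[R]_k) (t : R) :
  derivable F (y + t *: v) v ->
  is_derive t 1 (fun t => F (y + t *: v)) ('D_v F (y + t *: v)).
Proof.
have E : (fun h : R => h^-1 *: (((fun t =>
  F (y + t *: v)) \o shift t) (h *: 1) - F (y + t *: v))) =
    (fun h => h^-1 *: ((F \o shift (y + t *: v)) (h *: v) - F (y + t *: v))).
  by apply/funext => h /=; rewrite [h *: 1]mulr1 scalerDl addrCA.
move=> dF; apply: DeriveDef; first by rewrite /derivable E.
by rewrite /derive E.
Qed.

(** [is_C1] speaks of partial derivatives only, while the chain rule needs the full differential.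
    Going from [x] to [x + h] one coordinate at a time, the mean value theorem on each leg compares
    the increment with a partial derivative at [x]. *)
Lemma C1_littleo (F : 'rV[R]_k -> R) (x : 'rV[R]_k) : is_C1 F ->
  F \o shift x = cst (F x) + dotv (gradient F x) +o_ (0 : 'rV[R]_k) id.
Proof.
move=> C1F; apply/eqaddoP => _ /posnumP[e].
pose tr (m : nat) (h : 'rV[R]_k) : 'rV[R]_k := \row_j (if (j < m)%N then h 0 j else 0).
have tr_le m h : `|tr m h| <= `|h|.
  rewrite [in leLHS]/Num.norm/= mx_normrE; apply: bigmax_le => // -[i j] _ /=.
  by rewrite (ord1 i) mxE; case: ifP => _; rewrite ?normr0// normr_coord_le.
have K0 : 0 < k.+1%:R :> R by rewrite ltr0n.
(* There are [k] legs; dividing by [k.+1] keeps the share of each well defined for [k = 0]. *)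
have e'0 : 0 < e%:num / k.+1%:R by rewrite divr_gt0.
have : \forall y \near x, forall i,
  `|partial i F y - partial i F x| <= e%:num / k.+1%:R.
  apply: (@filter_forall _ _ (fun i y =>
    `|partial i F y - partial i F x| <= e%:num / k.+1%:R) (nbhs x)) => i;
    have [_ /(_ x)] := C1F i.
  by move=> /cvgrPdist_le /(_ _ e'0); apply: filterS => y; rewrite distrC.
move=> /nbhs_ballP[r /= r0 rP]; near=> h.
(* An intermediate point is a truncation of [h] plus part of one more leg away from [x], each of
   norm at most [|h|]. *)
have hr : 2 * `|h| < r.
  near: h; apply/nbhs_ballP; exists (r / 2) => /=; first by rewrite divr_gt0.
  by move=> h; rewrite -ball_normE /= sub0r normrN; lra.
rewrite /= !fctE /cst /=.
pose G m := F (x + tr m h).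
have G0 : G 0%N = F x.
  by rewrite /G (_ : tr 0%N h = 0) ?addr0//; apply/rowP => j; rewrite !mxE ltn0.
have Gk : G k = F (h + x).
  by rewrite /G addrC (_ : tr k h = h)//; apply/rowP => j; rewrite !mxE ltn_ord.
have step (m : 'I_k) : `|G m.+1 - G m - h 0 m * partial m F x| <= e%:num / k.+1%:R *
  `|h|.
  have [c ch E] := @MVT_at0 (fun t => F (x + tr m h + t *: delta_mx 0 m)) _ (h 0 m)
    (fun t => is_derive_line ((C1F m).1 _)).
  have -> : G m.+1 - G m = h 0 m * partial m F (x + tr m h + c *: delta_mx 0 m).
    rewrite -E scale0r addr0; congr (F _ - _); rewrite -addrA; congr (_ + _).
    apply/rowP => j; rewrite !mxE eqxx /= ltnS leq_eqVlt.
    have [->|jm] := eqVneq j m; first by rewrite eqxx /= ltnn add0r mulr1.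
    by rewrite (inj_eq val_inj) (negbTE jm) /= mulr0 addr0.
  rewrite -mulrBr normrM mulrC; apply: ler_pM => //; last exact: normr_coord_le.
  apply: rP; rewrite -ball_normE /= opprD addrA opprD !addrA subrr add0r -opprD normrN.
  apply: le_lt_trans (ler_normD _ _) _; rewrite normrZ; apply: le_lt_trans hr.
  rewrite mulr2n mulrDl mul1r; apply: lerD => //.
  have d1 : `|delta_mx 0 m : 'rV[R]_k| <= 1.
    rewrite [in leLHS]/Num.norm/= mx_normrE; apply: bigmax_le => // -[i j] _ /=.
    by rewrite mxE; case: (_ && _); rewrite ?normr1 ?normr0.
  rewrite -[leRHS]mulr1; apply: ler_pM => //.
  exact: le_trans ch (normr_coord_le _ _).
have -> : F (h + x) - (F x + dotv (gradient F x) h) =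
    \sum_(m < k) (G m.+1 - G m - h 0 m * partial m F x).
  rewrite sumrB opprD addrA; congr (_ - _); last first.
    by apply: eq_bigr => m _; rewrite !mxE.
  by rewrite -(big_mkord xpredT (fun m => G m.+1 - G m)) telescope_sumr// G0 Gk.
apply: le_trans (ler_norm_sum _ _ _) _.
apply: (le_trans (ler_sum _ (fun m _ => step m))).
rewrite sumr_const card_ord -[_ *+ k]mulr_natl mulrA; apply: ler_wpM2r => //.
rewrite mulrCA ler_piMr// ler_pdivrMr// mul1r ler_nat; exact: leqnSn.
Unshelve. all: end_near. Qed.

Lemma C1_differentiable (F : 'rV[R]_k -> R) (x : 'rV[R]_k) : is_C1 F ->
  differentiable F x /\ 'd F x = dotv (gradient F x) :> ('rV[R]_k -> R).
Proof.
move=> C1F; have Ho := C1_littleo x C1F.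
have dE : 'd F x = dotv (gradient F x) :> ('rV[R]_k -> R).
  by apply: diff_unique; [exact: dotv_continuous|exact: Ho].
split=> //; apply/diff_locallyP; rewrite dE; split => //; exact: dotv_continuous.
Qed.

Lemma C1_chain (F : 'rV[R]_k -> R) (p : R -> 'rV[R]_k) (v : 'rV[R]_k) (t : R) :
  is_C1 F -> (forall j, is_derive t 1 (fun t => p t 0 j) (v 0 j)) ->
  is_derive t 1 (fun t => F (p t)) (dotv (gradient F (p t)) v).
Proof.
move=> C1F dp.
have dpt : derivable p t 1.
  by apply/derivable_mxP => i j; rewrite (ord1 i); case: (dp j).
have pv : 'D_1 p t = v.
  rewrite derive_mx//; apply/rowP => j; rewrite mxE.
  by case: (dp j).
have [dF dFE] := C1_differentiable (p t) C1F.
have dpt' : differentiable p t by apply/derivable1_diffP.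
have dc : differentiable (F \o p) t by exact: differentiable_comp.
apply: DeriveDef; first exact/derivable1_diffP.
rewrite -[fun t => F (p t)]/(F \o p) deriveE// diff_comp//= dFE.
by congr (dotv _ _); rewrite -deriveE.
Qed.

Lemma C1_line (F : 'rV[R]_k -> R) (x h : 'rV[R]_k) (t : R) : is_C1 F ->
  is_derive t 1 (fun t => F (x + t *: h)) (dotv (gradient F (x + t *: h)) h).
Proof.
move=> C1F; apply: (@C1_chain F (fun t => x + t *: h)) => // j.
under eq_fun do rewrite !mxE.
by apply: is_derive_eq; rewrite /GRing.scale /=; ring.
Qed.

Lemma C1_cont (F : 'rV[R]_k -> R) : is_C1 F -> continuous F.
Proof. by move=> C1F x; apply: differentiable_continuous;
  case: (C1_differentiable x C1F). Qed.

Lemma dotvDr (c x y : 'rV[R]_k) : dotv c (x + y) = dotv c x + dotv c y.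
Proof. exact: linearD. Qed.
Lemma dotvBr (c x y : 'rV[R]_k) : dotv c (x - y) = dotv c x - dotv c y.
Proof. exact: linearB. Qed.
Lemma dotvZr (c x : 'rV[R]_k) a : dotv c (a *: x) = a * dotv c x.
Proof. exact: linearZ. Qed.
Lemma dotvDl (x y c : 'rV[R]_k) : dotv (x + y) c = dotv x c + dotv y c.
Proof. by rewrite !(dotvC _ c) dotvDr. Qed.
Lemma dotvBl (x y c : 'rV[R]_k) : dotv (x - y) c = dotv x c - dotv y c.
Proof. by rewrite !(dotvC _ c) dotvBr. Qed.
Lemma dotvZl (x c : 'rV[R]_k) a : dotv (a *: x) c = a * dotv x c.
Proof. by rewrite !(dotvC _ c) dotvZr. Qed.

(** Cauchy-Schwarz, from the sum of the squares of [A b_i - C a_i], which equals [A (A B - C^2)].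
    The index type is arbitrary because pairs of indices are used for the Hilbert-Schmidt
    product. *)
Lemma sqr_sum_le (I : finType) (a b : I -> R) :
  (\sum_i a i * b i) ^+ 2 <= (\sum_i a i ^+ 2) * (\sum_i b i ^+ 2).
Proof.
set A := \sum_i a i ^+ 2; set B := \sum_i b i ^+ 2; set C := \sum_i _.
have A0 : 0 <= A by apply: sumr_ge0 => i _; exact: sqr_ge0.
have [A_0|An0] := eqVneq A 0.
  have a0 i : a i = 0.
    apply/eqP; rewrite -sqrf_eq0; apply/eqP.
    have := A_0; rewrite /A => /eqP; rewrite psumr_eq0; last by move=> ? _;
      exact: sqr_ge0.
    by move=> /allP /(_ i); rewrite mem_index_enum => /(_ isT) /eqP.
  rewrite (_ : C = 0) ?expr0n ?A_0 ?mul0r//.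
  by apply: big1 => i _; rewrite a0 mul0r.
have Agt0 : 0 < A by rewrite lt_neqAle eq_sym An0.
have : 0 <= \sum_i (A * b i - C * a i) ^+ 2 by apply: sumr_ge0 => i _; exact: sqr_ge0.
have -> : \sum_i (A * b i - C * a i) ^+ 2 = A * (A * B - C ^+ 2).
  transitivity (A ^+ 2 * B - 2 * A * C * C + C ^+ 2 * A); last by ring.
  have -> : A ^+ 2 * B = \sum_i A ^+ 2 * b i ^+ 2 by rewrite mulr_sumr.
  have -> : 2 * A * C * C = \sum_i 2 * A * C * (a i * b i) by rewrite -mulr_sumr.
  have -> : C ^+ 2 * A = \sum_i C ^+ 2 * a i ^+ 2 by rewrite -mulr_sumr.
  rewrite -sumrB -big_split /=; apply: eq_bigr => i _; ring.
by rewrite pmulr_rge0// subr_ge0.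
Qed.

Lemma enorm_ge0 (x : 'rV[R]_k) : 0 <= enorm x. Proof. exact: sqrtr_ge0. Qed.
#[local] Hint Extern 0 (is_true (0 <= enorm _)) => solve [apply: enorm_ge0] : core.

Lemma enorm_sqr (x : 'rV[R]_k) : enorm x ^+ 2 = \sum_(i < k) x 0 i ^+ 2.
Proof. by rewrite sqr_sqrtr// sumr_ge0// => i _; exact: sqr_ge0. Qed.

Lemma dotvv (x : 'rV[R]_k) : dotv x x = enorm x ^+ 2.
Proof. by rewrite enorm_sqr; apply: eq_bigr => i _; rewrite expr2. Qed.

Lemma dotv_le (x y : 'rV[R]_k) : `|dotv x y| <= enorm x * enorm y.
Proof.
rewrite -(@ler_pXn2r _ 2)// ?nnegrE ?mulr_ge0//.
rewrite real_normK ?num_real// exprMn !enorm_sqr mulrC; exact: sqr_sum_le.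
Qed.

Lemma enormZ a (x : 'rV[R]_k) : enorm (a *: x) = `|a| * enorm x.
Proof.
rewrite /enorm -sqrtr_sqr -sqrtrM ?sqr_ge0//; congr Num.sqrt.
by rewrite mulr_sumr; apply: eq_bigr => i _; rewrite mxE exprMn.
Qed.

Lemma enorm_delta i : enorm (delta_mx 0 i : 'rV[R]_k) = 1.
Proof.
rewrite /enorm (bigD1 i)//= big1 ?addr0 ?mxE ?eqxx ?expr1n ?sqrtr1//.
by move=> j /negbTE ji; rewrite mxE ji /= expr0n.
Qed.

Lemma enorm_eq0 (x : 'rV[R]_k) : enorm x = 0 -> x = 0.
Proof.
move=> x0; have : \sum_(i < k) x 0 i ^+ 2 = 0 by rewrite -enorm_sqr x0 expr0n.
move=> /eqP; rewrite psumr_eq0; last by move=> ? _; exact: sqr_ge0.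
move=> /allP xi; apply/rowP => i; rewrite mxE; apply/eqP; rewrite -sqrf_eq0.
by apply: xi; rewrite mem_index_enum.
Qed.

Lemma coord_le_enorm (x : 'rV[R]_k) i : `|x 0 i| <= enorm x.
Proof.
rewrite -sqrtr_sqr ler_wsqrtr// (bigD1 i)//= lerDl sumr_ge0// => j _; exact: sqr_ge0.
Qed.

Lemma enorm_le_sum (x : 'rV[R]_k) : enorm x <= \sum_(i < k) `|x 0 i|.
Proof.
have S0 : 0 <= \sum_(i < k) `|x 0 i| by exact: sumr_ge0.
rewrite -(@ler_pXn2r _ 2)// ?nnegrE// enorm_sqr expr2 mulr_suml; apply: ler_sum => i _.
rewrite -(real_normK (num_real (x 0 i))) expr2; apply: ler_wpM2l => //.
by rewrite (bigD1 i)//= lerDl sumr_ge0.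
Qed.

Lemma derive_le_lipschitz (f : R -> R) (a K : R) :
  (forall t, `|f t - f 0| <= K * `|t|) -> is_derive (0 : R) 1 f a -> `|a| <= K.
Proof.
move=> fK [df dfa]; rewrite -dfa.
have H := df; rewrite /derivable in H.
have cn : `|h^-1 *: ((f \o shift 0) (h *: 1) - f 0)| @[h --> 0^'] --> `|'D_1 f 0|.
  exact: cvg_norm H.
apply: (cvgr_to_le cn); near=> h.
have h0 : h != 0 by near: h; exact: nbhs_dnbhs_neq.
rewrite /= [h *: 1]mulr1 addr0 normrZ normfV ler_pdivrMl ?normr_gt0// mulrC.
exact: fK.
Unshelve. all: end_near. Qed.

(** * Bounds on derivatives from Lipschitz constants *)

Section lipschitz.
Variables (g : 'rV[R]_k -> R) (m1 m2 : R).
Hypothesis g2 : is_C2 g.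
Hypothesis g_lip : forall x y, `|g x - g y| <= m1 * enorm (x - y).
Hypothesis dg_lip : forall x y,
  enorm (gradient g x - gradient g y) <= m2 * enorm (x - y).
Hypothesis m10 : 0 <= m1.

(** Differentiating along the gradient [c] itself turns the Lipschitz bound into
    [|c|^2 <= m1 |c|]. *)
Lemma enorm_gradient_le x : enorm (gradient g x) <= m1.
Proof.
set c := gradient g x.
have [c0|cn0] := eqVneq (enorm c) 0; first by rewrite c0.
have cgt0 : 0 < enorm c by rewrite lt_neqAle eq_sym cn0 enorm_ge0.
have : `|dotv c c| <= m1 * enorm c.
  apply: (@derive_le_lipschitz (fun t => g (x + t *: c))).
    move=> t; apply: le_trans (g_lip _ _) _; rewrite scale0r addr0 addrC addKr enormZ.
    by rewrite mulrA mulrAC.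
  by have := C1_line x c 0 g2.1; rewrite scale0r addr0.
by rewrite dotvv ger0_norm ?sqr_ge0// expr2 ler_pM2r.
Qed.

Lemma partial_le i x : `|partial i g x| <= m1.
Proof.
apply: le_trans (enorm_gradient_le x); have := coord_le_enorm (gradient g x) i.
by rewrite mxE.
Qed.

(** A crude entrywise bound, meant for integrability and domination; the constants of the theorem
    come from sharper estimates. *)
Lemma partial2_le i j x : `|partial i (partial j g) x| <= m2.
Proof.
apply: (@derive_le_lipschitz (fun t => partial j g (x + t *: delta_mx 0 i))).
  move=> t; rewrite scale0r addr0.
  have := coord_le_enorm (gradient g (x + t *: delta_mx 0 i) - gradient g x) j.
  rewrite !mxE => /le_trans; apply; apply: le_trans (dg_lip _ _) _.
  by rewrite addrC addKr enormZ enorm_delta mulr1.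
have := is_derive_line (F := partial j g) (y := x) (v := delta_mx 0 i) (t := 0) ((g2.2
  j i).1 _).
by rewrite scale0r addr0.
Qed.

End lipschitz.
End vectors.
#[local] Hint Extern 0 (is_true (0 <= enorm _)) => solve [apply: enorm_ge0] : core.

(** * Gaussian projections *)

Section smoothed_abs.
Context {R : realType}.
Variable e : R.
Hypothesis e0 : 0 < e.

(** A smooth substitute for [|t|], within [e] of it: the rotation argument integrates by parts
    against its derivative, which must itself be differentiable. *)
Definition sabs (t : R) : R := Num.sqrt (e ^+ 2 + t ^+ 2).

Lemma sabs_arg_gt0 t : 0 < e ^+ 2 + t ^+ 2.
Proof. by rewrite ltr_wpDr ?sqr_ge0 ?exprn_gt0. Qed.

Lemma sabs_gt0 t : 0 < sabs t.
Proof. by rewrite sqrtr_gt0 sabs_arg_gt0. Qed.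

Lemma sabs_sqr t : sabs t ^+ 2 = e ^+ 2 + t ^+ 2.
Proof. by rewrite sqr_sqrtr// ltW// sabs_arg_gt0. Qed.

Lemma sabs_ge_abs t : `|t| <= sabs t.
Proof. by rewrite -sqrtr_sqr ler_wsqrtr// lerDr sqr_ge0. Qed.

Lemma sabs_ge t : e <= sabs t.
Proof. by rewrite -[leLHS](gtr0_norm e0) -sqrtr_sqr ler_wsqrtr// lerDl sqr_ge0. Qed.

Lemma sabs_le t : sabs t <= `|t| + e.
Proof.
have te : 0 <= `|t| + e by rewrite addr_ge0// ltW.
have sn : sabs t \is Num.nneg by rewrite nnegrE ltW// sabs_gt0.
rewrite -(@ler_pXn2r _ 2)// sabs_sqr sqrrD.
by rewrite real_normK ?num_real//; have := mulr_ge0 (normr_ge0 t) (ltW e0); lra.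
Qed.

Lemma is_derive_sabs (t : R) : is_derive t 1 sabs (t / sabs t).
Proof.
have p := sabs_arg_gt0 t; have s0 : sabs t != 0 by rewrite gt_eqF ?sabs_gt0.
have H := is_derive1_sqrt p.
have H2 : is_derive t 1 (fun t : R => e ^+ 2 + t ^+ 2) (2 * t).
  by apply: is_derive_eq; rewrite /GRing.scale /=; ring.
have := @is_derive1_comp R Num.sqrt (fun t : R => e ^+ 2 + t ^+ 2) t _ _ H H2.
rewrite -/(sabs t) => H3; apply: (is_derive_eq H3).
by field.
Qed.

Lemma is_derive_sabs' (t : R) : is_derive t 1 (fun t =>
  t / sabs t) (e ^+ 2 / sabs t ^+ 3).
Proof.
have s0 : sabs t != 0 by rewrite gt_eqF ?sabs_gt0.
have H1 := is_derive_sabs t.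
have H2 := is_deriveV s0 H1.
apply: is_derive_eq.
rewrite /GRing.scale /= mulr1 (_ : e ^+ 2 = sabs t ^+ 2 - t ^+ 2);
  last by rewrite sabs_sqr; ring.
by field.
Qed.

Lemma sabs'_le t : `|t / sabs t| <= 1.
Proof.
by rewrite normrM normfV (gtr0_norm (sabs_gt0 t)) ler_pdivrMr ?sabs_gt0// mul1r
  sabs_ge_abs.
Qed.

(** The bound blows up as [e] tends to [0], but integration by parts asks only for some bound at
    fixed [e]. *)
Lemma sabs''_le t : `|e ^+ 2 / sabs t ^+ 3| <= e^-1.
Proof.
have s0 := sabs_gt0 t.
rewrite ger0_norm; last by rewrite divr_ge0 ?sqr_ge0// exprn_ge0// ltW.
rewrite ler_pdivrMr ?exprn_gt0// ler_pdivlMl// -exprS.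
by apply: lerXn2r; rewrite ?nnegrE ?(ltW e0) ?(ltW s0)// sabs_ge.
Qed.

Lemma sabs_continuous : continuous sabs.
Proof.
move=> t; apply/differentiable_continuous/derivable1_diffP.
by case: (is_derive_sabs t).
Qed.

Lemma sabs'_continuous : continuous (fun t : R => t / sabs t).
Proof.
move=> t; apply/differentiable_continuous/derivable1_diffP.
by case: (is_derive_sabs' t).
Qed.

Lemma sabs''_continuous : continuous (fun t : R => e ^+ 2 / sabs t ^+ 3).
Proof.
move=> t; apply: cvgM; first exact: cvg_cst.
apply: cvgV; first by rewrite expf_neq0// gt_eqF// sabs_gt0.
apply: (cvg_comp sabs (fun x : R => x ^+ 3));
  [exact: sabs_continuous|exact: exprn_continuous].
Qed.

End smoothed_abs.

Section gaussian_projection.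
Context {R : realType} {k : nat}.
Context d (T : measurableType d) (Q : probability T R).
Variable Z : {RV Q >-> borel_mx R 1 k}.
Hypothesis hZ : standard_gaussian Z.
Notation z i := (fun w => (Z w : 'rV[R]_k) 0 i).

Lemma integ_dotZ (c : 'rV[R]_k) : integ Q (fun w => dotv c (Z w)).
Proof.
by apply: integ_sum => i _; under eq_fun do rewrite mulrC; apply: integZ;
  exact: integ_Z.
Qed.

(** The integral on the right is the same for all [i], so a combination of these identities with
    coefficients orthogonal to [c] vanishes. *)
Lemma gauss_IBP_sabs e (c : 'rV[R]_k) i : 0 < e ->
  (\int[Q]_w (z i w * (dotv c (Z w) / sabs e (dotv c (Z w)))) =
   c 0 i * \int[Q]_w (e ^+ 2 / sabs e (dotv c (Z w)) ^+ 3))%R.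
Proof.
move=> e0.
have cd (f : R -> R) : continuous f -> continuous (fun x : 'rV[R]_k => f (dotv c x)).
  by move=> cf x; apply: (cvg_comp (dotv c) f); [exact: dotv_continuous|exact: cf].
have i3 : integ Q (fun w => e ^+ 2 / sabs e (dotv c (Z w)) ^+ 3).
  apply: (@integ_bounded _ _ _ _ _ e^-1) => [|w]; last exact: sabs''_le.
  exact: (measurable_continuousZ _ (cd _ (sabs''_continuous e0))).
rewrite -RintegralZl//.
apply: (gauss_IBP hZ (F := fun x => dotv c x / sabs e (dotv c x))
   (F' := fun x => c 0 i * (e ^+ 2 / sabs e (dotv c x) ^+ 3)) (b := `|c 0 i| * e^-1)).
- exact: (cd _ (sabs'_continuous e0)).
- apply: (cd (fun t => c 0 i * (e ^+ 2 / sabs e t ^+ 3))) => t.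
  by apply: cvgM; [exact: cvg_cst|exact: sabs''_continuous].
- move=> x t.
  have H1 := is_derive_sabs' e0 (dotv c (upd i t x)).
  have H2 : is_derive t 1 (fun t : R => dotv c (upd i t x)) (c 0 i).
    have -> : (fun t : R => dotv c (upd i t x)) = (fun t : R =>
      dotv c x - x 0 i * c 0 i + c 0 i * t).
      apply/funext => s; rewrite /upd dotvDr dotvZr.
      have -> : dotv c (delta_mx 0 i) = c 0 i.
        rewrite /dotv (bigD1 i)//= big1 ?addr0 ?mxE ?eqxx ?mul1r//.
        by move=> j /negbTE ji; rewrite mxE ji andbF mul0r.
      ring.
    by apply: is_derive_eq; rewrite /GRing.scale /=; ring.
  have H3 := @is_derive1_comp R (fun t => t / sabs e t) (fun t : R =>
    dotv c (upd i t x)) t _ _ H1 H2.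
  by apply: (is_derive_eq H3); rewrite mulrC.
- by move=> x; rewrite normrM; apply: ler_wpM2l => //; exact: sabs''_le.
- under eq_fun do rewrite mulrC.
  apply: (@integM _ _ _ _ (fun w => dotv c (Z w) / sabs e (dotv c (Z w))) _ 1).
  + exact: (measurable_continuousZ _ (cd _ (sabs'_continuous e0))).
  + by move=> w; exact: sabs'_le.
  + exact: integ_Z.
Qed.

(* The derivative in [t] is [dotv (p t) (p' t)] times a common factor, by
   integration by parts, and the curve [p] stays on a sphere. *)
Lemma sabs_rotation e (a b : 'rV[R]_k) (t : R) : 0 < e -> dotv a b = 0 -> enorm a =
  enorm b ->
  (\int[Q]_w sabs e (dotv (cos t *: a + sin t *: b) (Z w)) = \int[Q]_w sabs e (dotv a
    (Z w)))%R.
Proof.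
move=> e0 ab nab.
pose p (t : R) := cos t *: a + sin t *: b.
pose p' (t : R) := - sin t *: a + cos t *: b.
have dp (s : R) x : is_derive s 1 (fun s : R => dotv (p s) x) (dotv (p' s) x).
  rewrite (_ : (fun s : R => dotv (p s) x) = fun s =>
    cos s * dotv a x + sin s * dotv b x); last first.
    by apply/funext => u; rewrite /p dotvDl !dotvZl.
  apply: is_derive_eq; rewrite /GRing.scale /= /p' dotvDl !dotvZl; ring.
have pp' s : dotv (p s) (p' s) = 0.
  rewrite /p /p' !dotvDl !dotvZl !dotvDr !dotvZr (dotvC b a) ab !dotvv nab; ring.
pose G w := (enorm a + enorm b) * \sum_(i < k) `|z i w|.
have iG : integ Q G.
  by apply/integZ/integ_sum => i _; apply: integ_norm; exact: integ_Z.
have pG s w : `|dotv (p' s) (Z w)| <= G w.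
  apply: le_trans (dotv_le _ _) _; apply: ler_pM => //; last exact: enorm_le_sum.
  rewrite -(@ler_pXn2r _ 2)// ?nnegrE ?addr_ge0// -dotvv /p' !dotvDl !dotvZl !dotvDr
    !dotvZr (dotvC b a) ab !dotvv -nab.
  have -> : - sin s * (- sin s * enorm a ^+ 2 + cos s * 0) + cos s * (- sin s * 0 + cos
    s * enorm a ^+ 2) =
    (cos s ^+ 2 + sin s ^+ 2) * enorm a ^+ 2 by ring.
  rewrite cos2Dsin2 mul1r; have := enorm_ge0 a; nra.
have mS s : measurable_fun setT (fun w => sabs e (dotv (p s) (Z w))).
  apply: (measurable_continuousZ _ (F := fun x => sabs e (dotv (p s) x))).
  move=> x; apply: (cvg_comp (dotv (p s)) (sabs e));
    [exact: dotv_continuous|exact: sabs_continuous].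
have iS s : integ Q (fun w => sabs e (dotv (p s) (Z w))).
  apply: (integ_dom (mS s) _ (integD (integ_norm (integ_dotZ (p s))) (integ_cst Q e)))
    => w.
  by rewrite (gtr0_norm (sabs_gt0 e0 _)) sabs_le.
have dPhi (s : R) : is_derive s 1 (fun s : R =>
  (\int[Q]_w sabs e (dotv (p s) (Z w)))%R) 0.
  have H := @is_derive_under_integral _ _ _ Q (fun s w => sabs e (dotv (p s) (Z w)))
    (fun s w => dotv (p' s) (Z w) * (dotv (p s) (Z w) / sabs e (dotv (p s) (Z w)))) G s
      iS.
  apply: is_derive_eq; first apply: H => //.
  - move=> u w.
    have H1 := is_derive_sabs e0 (dotv (p u) (Z w)); have H2 := dp u (Z w).
    have H3 := @is_derive1_comp R (sabs e) (fun s : R => dotv (p s) (Z w)) u _ _ H1 H2.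
    by apply: (is_derive_eq H3); rewrite mulrC.
  - move=> u w; rewrite normrM -[leRHS]mulr1; apply: ler_pM => //; exact: sabs'_le.
  transitivity (\sum_(i < k) p' s 0 i * (\int[Q]_w (z i w * (dotv (p s) (Z w) / sabs e
    (dotv (p s) (Z w)))))%R).
    have iz i : integ Q (fun w =>
      z i w * (dotv (p s) (Z w) / sabs e (dotv (p s) (Z w)))).
      under eq_fun do rewrite mulrC.
      apply: (@integM _ _ _ _ (fun w =>
        dotv (p s) (Z w) / sabs e (dotv (p s) (Z w))) _ 1).
      + apply: (measurable_continuousZ _ (F := fun x =>
        dotv (p s) x / sabs e (dotv (p s) x))).
        move=> x; apply: (cvg_comp (dotv (p s)) (fun t => t / sabs e t));
          [exact: dotv_continuous|exact: sabs'_continuous].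
      + by move=> w; exact: sabs'_le.
      + exact: integ_Z.
    under [RHS]eq_bigr do rewrite -RintegralZl//.
    rewrite -Rint_sum; last by move=> i _; exact: integZ.
    apply: eq_Rintegral => w _; rewrite mulr_suml; apply: eq_bigr => i _.
    by ring.
  under eq_bigr do rewrite gauss_IBP_sabs// mulrA.
  rewrite -mulr_suml (_ : \sum_(i < k) _ = 0) ?mul0r//; exact: pp'.
have := is_derive_0_is_cst t 0 dPhi.
by rewrite /p cos0 sin0 scale1r scale0r addr0.
Qed.

(** A rotation in the plane of [c] and a coordinate axis reduces the mean to [Rint_absZ]; replacing
    [|t|] by [sabs e t] costs at most [e], which is arbitrary. *)
Lemma Rint_abs_dotZ (c : 'rV[R]_k) :
  (\int[Q]_w `|dotv c (Z w)| <= 2 * normal_peak 1 * enorm c)%R.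
Proof.
have [c0|cn0] := eqVneq (enorm c) 0.
  rewrite c0 mulr0 (enorm_eq0 c0).
  under eq_Rintegral do rewrite -[0]/(0 : 'rV[R]_k) dotvC linear0 normr0.
  by rewrite Rintegral_cst// mul0r.
have cgt0 : 0 < enorm c by rewrite lt_neqAle eq_sym cn0 enorm_ge0.
have [k0|[i _]] : #|'I_k| = 0%N \/ exists i : 'I_k, true.
  case: (posnP k) => [->|kp]; first by left; rewrite card_ord.
  by right; exists (Ordinal kp).
  case/eqP: cn0; rewrite /enorm big_pred0 ?sqrtr0// => i.
  by have := card0_eq k0 i.
have [u [cE u1]] : exists u : 'rV[R]_k, c = enorm c *: u /\ enorm u = 1.
  exists ((enorm c)^-1 *: c); rewrite scalerA divff// scale1r.
  by rewrite enormZ normfV gtr0_norm// mulVf.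
pose a := u 0 i.
have a1 : `|a| <= 1 by rewrite -u1 coord_le_enorm.
pose e_i : 'rV[R]_k := delta_mx 0 i.
have doteu x : dotv e_i x = x 0 i.
  rewrite /dotv (bigD1 i)//= big1 ?addr0 ?mxE ?eqxx ?mulr1//.
  by move=> j /negbTE ji; rewrite mxE ji andbF mulr0.
have Ei : (\int[Q]_w `|dotv (enorm c *: e_i) (Z w)| = 2 * normal_peak 1 * enorm c)%R.
  under eq_Rintegral do rewrite dotvZl doteu normrM (gtr0_norm cgt0).
  by rewrite RintegralZl ?(Rint_absZ hZ) 1?mulrC//; apply: integ_norm; exact: integ_Z.
(* If [a^2 = 1] then [u] is plus or minus the axis vector and there is no plane to rotate in. *)
have [a21|a2n1] := eqVneq (a ^+ 2) 1.
  have uE : u = a *: e_i.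
    apply/eqP; rewrite -subr_eq0; apply/eqP/enorm_eq0/eqP; rewrite -sqrf_eq0; apply/eqP.
    rewrite -dotvv dotvBl !dotvBr !dotvZl !dotvZr (dotvC u) !doteu dotvv u1 -/a !mxE
      !eqxx expr1n.
    have : a * a = 1 by rewrite -expr2.
    rewrite /=; nra.
  have aa : `|a| = 1 by apply/eqP;
    rewrite -(@eqrXn2 _ 2)// real_normK ?num_real// a21 expr1n.
  rewrite -Ei le_eqVlt; apply/orP; left; apply/eqP/eq_Rintegral => w _.
  by rewrite {1}cE uE !dotvZl !normrM aa mul1r.
have a2lt : a ^+ 2 < 1.
  rewrite lt_neqAle a2n1 /= -(real_normK (num_real a)) -[leRHS](expr1n _ 2).
  by apply: lerXn2r; rewrite ?nnegrE.
have s0 : 0 < Num.sqrt (1 - a ^+ 2) by rewrite sqrtr_gt0 subr_gt0.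
(* The Gram-Schmidt step: the normalized part of [u] orthogonal to the axis. Then [c] sits at angle
   [acos a] on the circle. *)
pose b := (Num.sqrt (1 - a ^+ 2))^-1 *: (u - a *: e_i).
have eib : dotv (enorm c *: e_i) (enorm c *: b) = 0.
  by rewrite dotvZl dotvZr /b dotvZr dotvBr dotvZr !doteu -/a mxE !eqxx mulr1 subrr
    !mulr0.
have nb : enorm (enorm c *: e_i) = enorm (enorm c *: b).
  rewrite !enormZ enorm_delta; congr (_ * _); apply/esym.
  rewrite normfV (gtr0_norm s0).
  rewrite /enorm; suff -> : \sum_(j < k) (u - a *: e_i) 0 j ^+ 2 = 1 - a ^+ 2 by
    rewrite mulVf ?gt_eqF.
  rewrite -enorm_sqr -dotvv dotvBl !dotvBr !dotvZl !dotvZr (dotvC u) !doteu dotvv u1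
    -/a !mxE !eqxx /=.
  ring.
have aI : -1 <= a <= 1 by rewrite -ler_norml.
have cdec : c = cos (acos a) *: (enorm c *: e_i) + sin (acos a) *: (enorm c *: b).
  rewrite sin_acos// acosK ?in_itv// /b.
  have -> : Num.sqrt (1 - a ^+ 2) *: (enorm c *: ((Num.sqrt (1 - a ^+ 2))^-1 *: (u - a
    *: e_i))) =
      enorm c *: (u - a *: e_i).
    by rewrite !scalerA mulrAC divff ?mul1r// gt_eqF.
  by rewrite scalerBr !scalerA (mulrC a) addrC subrK -cE.
have Re e : 0 < e -> (\int[Q]_w `|dotv c (Z w)| <= 2 * normal_peak 1 * enorm c + e)%R.
  move=> e0.
  have mS v : measurable_fun setT (fun w => sabs e (dotv v (Z w))).
    apply: (measurable_continuousZ _ (F := fun x => sabs e (dotv v x))).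
    by move=> x; apply: (cvg_comp (dotv v) (sabs e));
      [exact: dotv_continuous|exact: sabs_continuous].
  have iS v : integ Q (fun w => sabs e (dotv v (Z w))).
    apply: (integ_dom (mS v) _ (integD (integ_norm (integ_dotZ v)) (integ_cst Q e))) =>
      w.
    by rewrite (gtr0_norm (sabs_gt0 e0 _)) sabs_le.
  apply: (@le_trans _ _ (\int[Q]_w sabs e (dotv c (Z w)))%R).
    apply: (le_Rintegral measurableT (integ_norm (integ_dotZ c)) (iS c)) => w _.
    exact: sabs_ge_abs.
  rewrite {1}cdec sabs_rotation// -Ei -[X in _ + X](Rint_cst Q) -RintegralD//.
  - apply: (le_Rintegral measurableT (iS _) (integD (integ_norm (integ_dotZ _))
    (integ_cst Q e))) => w _.
    exact: sabs_le.
  - exact/integ_norm/integ_dotZ.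
  - exact: integ_cst.
by apply/ler_addgt0Pl => e e0; rewrite addrC; exact: Re.
Qed.

End gaussian_projection.

(** * Gaussian smoothing *)

Section smoothing.
Context {R : realType} {k : nat}.
Context d (T : measurableType d) (Q : probability T R).
Variable Z : {RV Q >-> borel_mx R 1 k}.
Hypothesis hZ : standard_gaussian Z.
Notation z i := (fun w => (Z w : 'rV[R]_k) 0 i).
Notation Zv w := (Z w : 'rV[R]_k).

(** The topology comes from the max norm, which bounds [enorm] up to the factor [k]; [k.+1] and
    [|K| + 1] avoid a division by zero. *)
Lemma lipschitz_continuous (F : 'rV[R]_k -> R) (K : R) :
  (forall x y, `|F x - F y| <= K * enorm (x - y)) -> continuous F.
Proof.
move=> FK x; rewrite /continuous_at;
  apply/(@cvgrPdist_le _ _ _ (nbhs x) (nbhs_filter x)) => e e0.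
have n1 : 0 < k.+1%:R * (`|K| + 1) :> R.
  by apply: mulr_gt0; [rewrite ltr0n|rewrite ltr_wpDl].
apply/nbhs_ballP; exists (e / (k.+1%:R * (`|K| + 1))) => /=; first by rewrite divr_gt0.
move=> y; rewrite -ball_normE /= ltr_pdivlMr// => xy.
apply: (le_trans (FK _ _)); apply: le_trans (ltW xy).
apply: (@le_trans _ _ ((`|K| + 1) * enorm (x - y))).
  by apply: ler_wpM2r => //; rewrite (le_trans (ler_norm _))// lerDl.
rewrite mulrA mulrC; apply: ler_wpM2r; first by rewrite addr_ge0.
apply: le_trans (enorm_le_sum _) _.
apply: (le_trans (ler_sum _ (fun i _ => normr_coord_le (x - y) i))).
rewrite sumr_const card_ord -[_ *+ k]mulr_natr; apply: ler_wpM2l => //.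
by rewrite ler_nat.
Qed.

Lemma continuous_affine (F : 'rV[R]_k -> R) (y : 'rV[R]_k) (r : R) : continuous F ->
  continuous (fun x : 'rV[R]_k => F (y + r *: x)).
Proof.
move=> cF x; apply: (@continuous_comp _ _ _ (fun x : 'rV[R]_k => y + r *: x) F);
  last exact: cF.
apply: (@continuousD _ _ _ (fun=> y) (fun x => r *: x)); first exact: cst_continuous.
exact: scaler_continuous.
Qed.

Variables (g : 'rV[R]_k -> R) (m1 m2 : R).
Hypothesis g2 : is_C2 g.
Hypothesis m10 : 0 <= m1.
Hypothesis g_lip : forall x y, `|g x - g y| <= m1 * enorm (x - y).
Hypothesis dg_lip : forall x y,
  enorm (gradient g x - gradient g y) <= m2 * enorm (x - y).

(** An integrable majorant of the Euclidean norm of [Z]. *)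
Definition S_Z := fun w => \sum_(i < k) `|z i w|.

Lemma integ_SZ : integ Q S_Z.
Proof. by apply: integ_sum => i _; apply: integ_norm; exact: integ_Z. Qed.

Definition smooth (F : 'rV[R]_k -> R) (s r : R) (x : 'rV[R]_k) : R :=
  (\int[Q]_w F (s *: x + r *: Zv w))%R.

(* By Gaussian integration by parts this is [r] times the smoothed second
   partial derivative, but it is bounded in terms of first derivatives only. *)
Definition smoothZ (i j : 'I_k) (s r : R) (x : 'rV[R]_k) : R :=
  (\int[Q]_w (z i w * partial j g (s *: x + r *: Zv w)))%R.

Lemma cont_partial j : continuous (partial j g).
Proof. exact: (g2.1 j).2. Qed.

Lemma cont_partial2 i j : continuous (partial i (partial j g)).
Proof. exact: (g2.2 j i).2. Qed.

Lemma measurable_affineZ (F : 'rV[R]_k -> R) y r : continuous F ->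
  measurable_fun setT (fun w => F (y + r *: Zv w)).
Proof.
move=> cF; apply: (measurable_continuousZ Z (F := fun x => F (y + r *: x))).
exact: continuous_affine.
Qed.

Lemma g_growth y r w : `|g (y + r *: Zv w)| <= `|g y| + m1 * `|r| * S_Z w.
Proof.
rewrite -[g (y + _)](subrK (g y)) addrC; apply: le_trans (ler_normD _ _) _.
rewrite lerD2l; apply: le_trans (g_lip _ _) _; rewrite addrC addKr enormZ -mulrA.
do 2 apply: ler_wpM2l => //; exact: enorm_le_sum.
Qed.

Lemma integ_g y r : integ Q (fun w => g (y + r *: Zv w)).
Proof.
apply: (integ_dom _ (g_growth y r)).
  exact/measurable_affineZ/C1_cont/g2.1.
by apply: integD; [exact: integ_cst|exact/integZ/integ_SZ].
Qed.

Lemma integ_partial j y r : integ Q (fun w => partial j g (y + r *: Zv w)).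
Proof.
apply: (@integ_bounded _ _ _ _ _ m1) => [|w];
  first exact/measurable_affineZ/cont_partial.
exact: partial_le.
Qed.

Lemma integ_Zpartial i j y r : integ Q (fun w => z i w * partial j g (y + r *: Zv w)).
Proof.
under eq_fun do rewrite mulrC.
apply: (@integM _ _ _ _ (fun w => partial j g (y + r *: Zv w)) _ m1).
- exact/measurable_affineZ/cont_partial.
- by move=> w; exact: partial_le.
- exact: integ_Z.
Qed.

Lemma integ_partial2 i j y r : integ Q (fun w =>
  partial i (partial j g) (y + r *: Zv w)).
Proof.
apply: (@integ_bounded _ _ _ _ _ m2) => [|w];
  first exact/measurable_affineZ/cont_partial2.
exact: (partial2_le g2 dg_lip).
Qed.

Lemma IBP_partial i j y r :
  (\int[Q]_w (z i w * partial j g (y + r *: Zv w)) =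
   r * \int[Q]_w partial i (partial j g) (y + r *: Zv w))%R.
Proof.
rewrite -(RintegralZl r measurableT (integ_partial2 i j y r)).
have cF : continuous (fun x : 'rV[R]_k => partial j g (y + r *: x)).
  exact/continuous_affine/cont_partial.
have cF' : continuous (fun x : 'rV[R]_k => r * partial i (partial j g) (y + r *: x)).
  apply: (continuous_affine (F := fun x => r * partial i (partial j g) x)) => x.
  by apply: continuousM; [exact: cst_continuous|exact: cont_partial2].
have bF (x : 'rV[R]_k) : `|r * partial i (partial j g) (y + r *: x)| <= `|r| * m2.
  by rewrite normrM; apply: ler_wpM2l => //; exact: (partial2_le g2 dg_lip).
have dF (x : 'rV[R]_k) (t : R) : is_derive t 1 (fun t =>
  partial j g (y + r *: upd i t x))
    (r * partial i (partial j g) (y + r *: upd i t x)).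
  have dp l : is_derive t 1 (fun t : R =>
    (y + r *: upd i t x) 0 l) ((r *: delta_mx 0 i : 'rV[R]_k) 0 l).
    under [fun _ => _]eq_fun do rewrite !mxE.
    by apply: is_derive_eq; rewrite !mxE /GRing.scale /=; ring.
  have := C1_chain (g2.2 j) dp.
  rewrite dotvZr (_ : dotv _ (delta_mx 0 i) = partial i (partial j g) (y + r *: upd i t
    x))//.
  rewrite /dotv (bigD1 i)//= big1 ?addr0 ?mxE ?eqxx ?mul1r ?mxE//.
  by move=> l /negbTE li; rewrite mxE li andbF mul0r.
exact: (@gauss_IBP _ _ _ _ _ _ hZ i _ _ _ cF cF' dF bF (integ_Zpartial i j y r)).
Qed.

Lemma is_derive_smooth (s r : R) (x h : 'rV[R]_k) (t : R) :
  is_derive t 1 (fun t => smooth g s r (x + t *: h))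
    (s * \sum_(j < k) h 0 j * smooth (partial j g) s r (x + t *: h)).
Proof.
pose G (_ : T) : R := m1 * enorm (s *: h).
pose f (t : R) w := g (s *: (x + t *: h) + r *: Zv w).
pose f' (t : R) w := dotv (gradient g (s *: (x + t *: h) + r *: Zv w)) (s *: h).
have if_ u : integ Q (f u) by exact: integ_g.
have df (u : R) w : is_derive u 1 (f^~ w) (f' u w).
  have dp l : is_derive u 1 (fun u : R =>
    (s *: (x + u *: h) + r *: Zv w) 0 l) ((s *: h) 0 l).
    under [fun _ => _]eq_fun do rewrite !mxE.
    by apply: is_derive_eq; rewrite !mxE /GRing.scale /=; ring.
  exact: C1_chain g2.1 dp.
have f'G u w : `|f' u w| <= G w.
  apply: le_trans (dotv_le _ _) _; apply: ler_wpM2r => //.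
  exact: (enorm_gradient_le g2 g_lip).
have H := is_derive_under_integral t if_ df f'G (integ_cst Q _).
apply: (is_derive_eq H).
rewrite /smooth mulr_sumr.
under [RHS]eq_bigr => j _ do
  rewrite mulrA -(RintegralZl _ measurableT (integ_partial j _ _)).
rewrite -Rint_sum; last by move=> j _; exact/integZ/integ_partial.
by apply: eq_Rintegral => w _; apply: eq_bigr => j _; rewrite !mxE.
Qed.

(** Differentiation under the integral gives [s] times smoothed second partial derivatives, which
    [IBP_partial] trades for [smoothZ] at the cost of dividing by [r]. *)
Lemma is_derive_smooth_partial (s r : R) (x h : 'rV[R]_k) (t : R) j : r != 0 ->
  is_derive t 1 (fun t => smooth (partial j g) s r (x + t *: h))
    (s / r * \sum_(i < k) h 0 i * smoothZ i j s r (x + t *: h)).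
Proof.
move=> r0.
pose G (_ : T) : R := \sum_(i < k) m2 * `|(s *: h) 0 i|.
pose f (t : R) w := partial j g (s *: (x + t *: h) + r *: Zv w).
pose f' (t : R) w := dotv (gradient (partial j g) (s *: (x + t *: h) + r *: Zv w)) (s
  *: h).
have if_ u : integ Q (f u) by exact: integ_partial.
have df (u : R) w : is_derive u 1 (f^~ w) (f' u w).
  have dp l : is_derive u 1 (fun u : R =>
    (s *: (x + u *: h) + r *: Zv w) 0 l) ((s *: h) 0 l).
    under [fun _ => _]eq_fun do rewrite !mxE.
    by apply: is_derive_eq; rewrite !mxE /GRing.scale /=; ring.
  exact: C1_chain (g2.2 j) dp.
have f'G u w : `|f' u w| <= G w.
  apply: le_trans (ler_norm_sum _ _ _) _; apply: ler_sum => i _.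
  rewrite normrM mulrC; apply: ler_wpM2r => //; rewrite mxE.
  exact: (partial2_le g2 dg_lip).
have H := is_derive_under_integral t if_ df f'G (integ_cst Q _).
apply: (is_derive_eq H).
rewrite mulr_sumr.
transitivity (\sum_(i < k) \int[Q]_w (s * h 0 i * partial i (partial j g) (s *: (x + t
  *: h) + r *: Zv w)))%R.
  rewrite -Rint_sum; last by move=> i _; exact/integZ/integ_partial2.
  by apply: eq_Rintegral => w _; apply: eq_bigr => i _; rewrite !mxE.
apply: eq_bigr => i _; rewrite (RintegralZl _ measurableT (integ_partial2 i j _ _)).
by rewrite /smoothZ IBP_partial; field.
Qed.

(** Writing the quadratic form as one integral lets a difference of two such forms be bounded
    through [E |<h, Z>|] with no loss in the dimension, unlike an entrywise estimate. *)
Lemma Rint_dotZ_gradient (s r : R) (x h : 'rV[R]_k) :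
  integ Q (fun w => dotv h (Zv w) * dotv (gradient g (s *: x + r *: Zv w)) h) /\
  (\int[Q]_w (dotv h (Zv w) * dotv (gradient g (s *: x + r *: Zv w)) h) =
   \sum_(j < k) \sum_(i < k) h 0 j * h 0 i * smoothZ i j s r x)%R.
Proof.
have E w : dotv h (Zv w) * dotv (gradient g (s *: x + r *: Zv w)) h =
    \sum_(j < k) \sum_(i < k) h 0 j * h 0 i * (z i w * partial j g (s *: x + r *: Zv
      w)).
  rewrite mulrC mulr_suml; apply: eq_bigr => j _.
  by rewrite mulr_sumr; apply: eq_bigr => i _; rewrite mxE; ring.
have I2 j i : integ Q (fun w =>
  h 0 j * h 0 i * (z i w * partial j g (s *: x + r *: Zv w))).
  exact/integZ/integ_Zpartial.
have I1 j : integ Q (fun w =>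
  \sum_(i < k) h 0 j * h 0 i * (z i w * partial j g (s *: x + r *: Zv w))).
  by apply: integ_sum => i _; exact: I2.
split; first by under eq_fun do rewrite E; apply: integ_sum => j _; exact: I1.
under eq_Rintegral do rewrite E.
rewrite (Rint_sum (fun j _ => I1 j)); apply: eq_bigr => j _.
rewrite (Rint_sum (fun i _ => I2 j i)); apply: eq_bigr => i _.
by rewrite (RintegralZl _ measurableT (integ_Zpartial i j _ _)).
Qed.

Lemma smooth_taylor (s r : R) (x h : 'rV[R]_k) : 0 <= s -> 0 < r -> 0 <= m2 ->
  `|smooth g s r (x + h) - smooth g s r x
    - s * (\sum_(j < k) h 0 j * smooth (partial j g) s r x)
    - s ^+ 2 / (2 * r) * (\sum_(j < k) \sum_(i < k) h 0 j * h 0 i * smoothZ i j s r x)|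
  <= s ^+ 3 / r * (2 * normal_peak 1) * (m2 * enorm h ^+ 3) / 6.
Proof.
move=> s0 r0 m20; have rn0 : r != 0 by rewrite gt_eqF.
pose f (t : R) := smooth g s r (x + t *: h).
pose f1 (t : R) := s * \sum_(j < k) h 0 j * smooth (partial j g) s r (x + t *: h).
pose f2 (t : R) := s * \sum_(j < k) h 0 j * (s / r * \sum_(i < k) h 0 i * smoothZ i j s
  r (x + t *: h)).
have d1 (t : R) : is_derive t 1 f (f1 t) by exact: is_derive_smooth.
have d2 (t : R) : is_derive t 1 f1 (f2 t).
  have D j := @is_derive_smooth_partial s r x h t j (lt0r_neq0 r0).
  have D' := @is_derive_sum R R R k (fun j t =>
    h 0 j * smooth (partial j g) s r (x + t *: h)) t 1
     (fun j => h 0 j * (s / r * \sum_(i < k) h 0 i * smoothZ i j s r (x + t *: h)))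
       (fun j => is_deriveZ (h 0 j) (D j)).
  have := is_deriveZ s D'.
  by rewrite fct_sumE.
have f2E t : f2 t = s ^+ 2 / r * (\sum_(j < k) \sum_(i < k) h 0 j * h 0 i * smoothZ i j
  s r (x + t *: h)).
  rewrite /f2 !mulr_sumr; apply: eq_bigr => j _.
  rewrite !mulr_sumr; apply: eq_bigr => i _; field.
  exact: rn0.
have f2L t : 0 <= t -> `|f2 t - f2 0| <= s ^+ 3 / r * (2 * normal_peak 1) * (m2 * enorm
  h ^+ 3) * t.
  move=> t0; have [I1 E1] := Rint_dotZ_gradient s r (x + t *: h) h.
  have [I0 E0] := Rint_dotZ_gradient s r x h.
  have -> : f2 t - f2 0 = s ^+ 2 / r *
      (\int[Q]_w (dotv h (Zv w) * dotv (gradient g (s *: (x + t *: h) + r *: Zv w)) h -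
       dotv h (Zv w) * dotv (gradient g (s *: x + r *: Zv w)) h))%R.
    by rewrite (RintegralB measurableT I1 I0) E1 E0 !f2E scale0r addr0 mulrBr.
  rewrite normrM.
  have sr0 : 0 <= s ^+ 2 / r by apply: divr_ge0; [exact: sqr_ge0|exact: ltW].
  rewrite (ger0_norm sr0).
  (* The gradients are taken at points [s t h] apart, so their difference paired with [h] is at most
     [K]; the last factor [|h|] comes from [E |<h, Z>|]. *)
  pose K := m2 * s * t * enorm h ^+ 2.
  have K0 : 0 <= K by rewrite !mulr_ge0 ?sqr_ge0.
  have B : `|\int[Q]_w (dotv h (Zv w) * dotv (gradient g (s *: (x + t *: h) + r *: Zv
    w)) h -
       dotv h (Zv w) * dotv (gradient g (s *: x + r *: Zv w)) h)| <= K * (2 *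
         normal_peak 1 * enorm h).
    apply: (@le_trans _ _ (\int[Q]_w (K * `|dotv h (Zv w)|))%R); last first.
      rewrite (RintegralZl _ measurableT (integ_norm (integ_dotZ hZ h))).
      by apply: ler_wpM2l => //; exact: Rint_abs_dotZ.
    apply: Rint_abs_le.
    - exact: integ_measurable (integB I1 I0).
    - exact/integZ/integ_norm/integ_dotZ.
    - move=> w; rewrite -mulrBr -dotvBl normrM mulrC; apply: ler_wpM2r => //.
      apply: le_trans (dotv_le _ _) _; rewrite /K expr2 mulrA; apply: ler_wpM2r => //.
      apply: le_trans (dg_lip _ _) _.
      rewrite (_ : _ - _ = (s * t) *: h); last first.
        by rewrite scalerDr opprD addrACA subrr addr0 addrAC subrr add0r scalerA.
      by rewrite enormZ ger0_norm ?mulr_ge0// !mulrA.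
  apply: le_trans (ler_wpM2l sr0 B) _; rewrite /K le_eqVlt; apply/orP; left; apply/eqP;
    field.
  exact: rn0.
have := taylor2 d1 d2 f2L; rewrite f2E /f /f1 scale1r scale0r addr0.
by rewrite (_ : s ^+ 2 / (2 * r) * _ = s ^+ 2 / r * (\sum_(j < k) \sum_(i < k) h 0 j *
  h 0 i * smoothZ i j s r x) / 2)//; field.
Qed.

(* Bessel's inequality for the orthonormal coordinates of [Z], applied to each
   partial derivative of [g]. *)
Lemma smoothZ_sqr_le (s r : R) (x : 'rV[R]_k) :
  \sum_(j < k) \sum_(i < k) smoothZ i j s r x ^+ 2 <= m1 ^+ 2.
Proof.
pose f j w := partial j g (s *: x + r *: Zv w).
have fi j : integ Q (f j) by exact: integ_partial.
have mf j := integ_measurable (fi j).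
have f2i j : integ Q (fun w => f j w ^+ 2).
  apply: (@integ_bounded _ _ _ _ _ (m1 ^+ 2)) => [|w]; first exact: measurable_funX.
  rewrite normrX; apply: lerXn2r; rewrite ?nnegrE//; exact: partial_le.
have bessel j : \sum_(i < k) smoothZ i j s r x ^+ 2 <= (\int[Q]_w (f j w ^+ 2))%R.
  pose a i := smoothZ i j s r x.
  have ZZ i l : integ Q (fun w => a i * a l * (z i w * z l w)) by exact/integZ/integ_ZZ.
  have Zf i : integ Q (fun w =>
    2 * a i * (z i w * f j w)) by exact/integZ/integ_Zpartial.
  have I1 : integ Q (fun w => \sum_(i < k) 2 * a i * (z i w * f j w)).
    by apply: integ_sum => i _.
  have I2 i : integ Q (fun w => \sum_(l < k) a i * a l * (z i w * z l w)).
    by apply: integ_sum => l _; exact: ZZ.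
  have I3 : integ Q (fun w => \sum_(i < k) \sum_(l < k) a i * a l * (z i w * z l w)).
    by apply: integ_sum => i _; exact: I2.
  have : 0 <= (\int[Q]_w ((f j w - \sum_(i < k) a i * z i w) ^+ 2))%R.
    by apply: Rintegral_ge0 => w _; exact: sqr_ge0.
  have -> : (\int[Q]_w ((f j w - \sum_(i < k) a i * z i w) ^+ 2) =
     \int[Q]_w (f j w ^+ 2 - \sum_(i < k) 2 * a i * (z i w * f j w) +
       \sum_(i < k) \sum_(l < k) a i * a l * (z i w * z l w)))%R.
    apply: eq_Rintegral => w _; rewrite sqrrB; congr (_ - _ + _).
      by rewrite -mulr_natl mulrA mulr_sumr; apply: eq_bigr => i _; ring.
    rewrite expr2 mulr_suml; apply: eq_bigr => i _; rewrite mulr_sumr.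
    by apply: eq_bigr => l _; ring.
  rewrite (RintegralD measurableT (integB (f2i j) I1) I3) (RintegralB measurableT (f2i
    j) I1).
  rewrite (Rint_sum (fun i _ => Zf i)) (Rint_sum (fun i _ => I2 i)).
  have -> : \sum_(i < k) (\int[Q]_w (2 * a i * (z i w * f j w)))%R = 2 * \sum_(i < k) a
    i ^+ 2.
    rewrite mulr_sumr; apply: eq_bigr => i _.
    by rewrite (RintegralZl _ measurableT (integ_Zpartial i j _ _)) -/(smoothZ i j s r
      x) -/(a i); ring.
  have -> : \sum_(i < k) (\int[Q]_w (\sum_(l < k) a i * a l * (z i w * z l w)))%R =
    \sum_(i < k) a i ^+ 2.
    apply: eq_bigr => i _; rewrite (Rint_sum (fun l _ => ZZ i l)) (bigD1 i)//= big1 =>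
      [|l li].
      by rewrite (RintegralZl _ measurableT (integ_ZZ hZ i i)) Rint_ZZ// eqxx mulr1
        addr0 expr2.
    by rewrite (RintegralZl _ measurableT (integ_ZZ hZ i l)) Rint_ZZ// eq_sym (negbTE
      li) mulr0.
  by rewrite /a; lra.
apply: (le_trans (ler_sum _ (fun j _ => bessel j))).
rewrite -(Rint_sum (fun j _ => f2i j)).
rewrite -[leRHS](Rint_cst Q); apply: le_Rintegral => //.
- by apply: integ_sum => j _.
- exact: integ_cst.
move=> w _; have := enorm_gradient_le g2 g_lip m10 (s *: x + r *: Zv w).
rewrite -(@ler_pXn2r _ 2)// ?nnegrE// enorm_sqr; congr (_ <= _).
by apply: eq_bigr => j _; rewrite mxE.
Qed.

(** Provides continuity, and hence measurability after composition with [X], as well as linear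
    growth. *)
Lemma smooth_lipschitz (F : 'rV[R]_k -> R) (K : R) (s r : R) x y :
  (forall x y, `|F x - F y| <= K * enorm (x - y)) ->
  (forall x, integ Q (fun w => F (s *: x + r *: Zv w))) ->
  `|smooth F s r x - smooth F s r y| <= K * `|s| * enorm (x - y).
Proof.
move=> FK iF; rewrite /smooth -(RintegralB measurableT (iF x) (iF y)).
apply: Rint_bounded; first exact: integ_measurable (integB (iF x) (iF y)).
move=> w; apply: le_trans (FK _ _) _.
by rewrite opprD addrACA subrr addr0 -scalerBr enormZ mulrA.
Qed.

Lemma partial_lipschitz j x y : `|partial j g x - partial j g y| <= m2 * enorm (x - y).
Proof.
apply: le_trans (dg_lip x y); have := coord_le_enorm (gradient g x - gradient g y) j.
by rewrite !mxE.
Qed.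

Lemma continuous_smooth s r : continuous (smooth g s r).
Proof.
apply: (@lipschitz_continuous _ (m1 * `|s|)) => x y.
by apply: smooth_lipschitz => // u; exact: integ_g.
Qed.

Lemma continuous_smooth_partial j s r : continuous (smooth (partial j g) s r).
Proof.
apply: (@lipschitz_continuous _ (m2 * `|s|)) => x y.
by apply: smooth_lipschitz => [|u]; [exact: partial_lipschitz|exact: integ_partial].
Qed.

Lemma continuous_smoothZ i j s r : continuous (smoothZ i j s r).
Proof.
apply: (@lipschitz_continuous _ ((\int[Q]_w `|z i w|)%R * (m2 * `|s|))) => x y.
rewrite /smoothZ -(RintegralB measurableT (integ_Zpartial i j _ _) (integ_Zpartial i j
  _ _)).
have iz : integ Q (fun w => `|z i w|) by apply: integ_norm; exact: integ_Z.
rewrite -mulrA mulrC -(RintegralZl _ measurableT iz); apply: Rint_abs_le.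
- exact: integ_measurable (integB (integ_Zpartial i j _ _) (integ_Zpartial i j _ _)).
- exact: integZ.
move=> w; rewrite -mulrBr normrM mulrC; apply: ler_wpM2r => //.
apply: le_trans (partial_lipschitz _ _ _) _.
by rewrite opprD addrACA subrr addr0 -scalerBr enormZ mulrA.
Qed.

Lemma smooth_partial_le j s r x : `|smooth (partial j g) s r x| <= m1.
Proof.
apply: Rint_bounded; first exact: integ_measurable (integ_partial j _ _).
by move=> w; exact: partial_le.
Qed.

Lemma sqr_le_sum_sqr (a : 'I_k -> 'I_k -> R) i j :
  a j i ^+ 2 <= \sum_(j < k) \sum_(i < k) a j i ^+ 2.
Proof.
rewrite (bigD1 j)//= (bigD1 i)//= -addrA lerDl addr_ge0//.
  by apply: sumr_ge0 => l _; exact: sqr_ge0.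
by apply: sumr_ge0 => l _; apply: sumr_ge0 => n _; exact: sqr_ge0.
Qed.

Lemma smoothZ_le i j s r x : `|smoothZ i j s r x| <= m1.
Proof.
rewrite -(@ler_pXn2r _ 2)// ?nnegrE// real_normK ?num_real//.
apply: le_trans (smoothZ_sqr_le s r x).
exact: (sqr_le_sum_sqr (fun j i => smoothZ i j s r x)).
Qed.

(** The [Z] part of the velocity produces the diagonal [smoothZ j j] directly, with no integration
    by parts, so the formula holds also where [cos t = 0]. *)
Lemma is_derive_rotation (sigma t : R) (x : 'rV[R]_k) :
  is_derive t 1 (fun t => smooth g (sin t) (cos t * sigma) x)
    (cos t * (\sum_(j < k) x 0 j * smooth (partial j g) (sin t) (cos t * sigma) x)
     - sin t * sigma * (\sum_(j < k) smoothZ j j (sin t) (cos t * sigma) x)).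
Proof.
pose f (t : R) w := g (sin t *: x + (cos t * sigma) *: Zv w).
pose v (t : R) w := cos t *: x - (sin t * sigma) *: Zv w.
pose f' (t : R) w := dotv (gradient g (sin t *: x + (cos t * sigma) *: Zv w)) (v t w).
pose G w := m1 * (\sum_(j < k) (`|x 0 j| + `|sigma| * `|z j w|)).
have if_ u : integ Q (f u) by exact: integ_g.
have df (u : R) w : is_derive u 1 (f^~ w) (f' u w).
  have dp l : is_derive u 1 (fun u : R =>
    (sin u *: x + (cos u * sigma) *: Zv w) 0 l) (v u w 0 l).
    under [fun _ => _]eq_fun do rewrite !mxE.
    by apply: is_derive_eq; rewrite !mxE /GRing.scale /=; ring.
  exact: C1_chain g2.1 dp.
have iG : integ Q G.
  apply/integZ/integ_sum => j _; apply: integD; first exact: integ_cst.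
  by apply/integZ/integ_norm; exact: integ_Z.
have f'G u w : `|f' u w| <= G w.
  apply: le_trans (dotv_le _ _) _; apply: ler_pM => //.
    exact: (enorm_gradient_le g2 g_lip).
  apply: le_trans (enorm_le_sum _) _; apply: ler_sum => j _.
  rewrite !mxE; apply: le_trans (ler_normB _ _) _; rewrite !normrM.
  have cu : `|cos u| <= 1 by rewrite ler_norml cos_geN1 cos_le1.
  have su : `|sin u| <= 1 by rewrite ler_norml sin_geN1 sin_le1.
  by apply: lerD; [rewrite ler_piMl|apply: ler_wpM2r => //; rewrite ler_piMl].
have H := is_derive_under_integral t if_ df f'G iG.
apply: (is_derive_eq H).
pose y w := sin t *: x + (cos t * sigma) *: Zv w.
have I1 j : integ Q (fun w =>
  cos t * x 0 j * partial j g (y w)) by exact/integZ/integ_partial.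
have I2 j : integ Q (fun w =>
  sin t * sigma * (z j w * partial j g (y w))) by exact/integZ/integ_Zpartial.
transitivity (\sum_(j < k) (\int[Q]_w (cos t * x 0 j * partial j g (y w) - sin t *
  sigma * (z j w * partial j g (y w))))%R).
  rewrite -Rint_sum; last by move=> j _; exact: integB.
  by apply: eq_Rintegral => w _; apply: eq_bigr => j _; rewrite !mxE /y; ring.
rewrite !mulr_sumr -sumrB; apply: eq_bigr => j _.
rewrite (RintegralB measurableT (I1 j) (I2 j)).
rewrite (RintegralZl _ measurableT (integ_partial j _ _)) (RintegralZl _ measurableT
  (integ_Zpartial j j _ _)).
by rewrite mulrA.
Qed.

(** Uniform in [t] and linear in [x]: this is the domination for differentiating once more under the
    integral over [X]. *)
Lemma rotation_derive_le (sigma t : R) (x : 'rV[R]_k) : 0 <= sigma ->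
  `|cos t * (\sum_(j < k) x 0 j * smooth (partial j g) (sin t) (cos t * sigma) x)
     - sin t * sigma * (\sum_(j < k) smoothZ j j (sin t) (cos t * sigma) x)|
  <= m1 * (\sum_(j < k) `|x 0 j|) + k%:R * (sigma * m1).
Proof.
move=> s0; apply: le_trans (ler_normB _ _) _; apply: lerD.
  rewrite normrM; have cu : `|cos t| <= 1 by rewrite ler_norml cos_geN1 cos_le1.
  apply: (@le_trans _ _ (1 * `|\sum_(j < k) x 0 j * smooth (partial j g) (sin t) (cos t
    * sigma) x|)).
    exact: ler_wpM2r.
  rewrite mul1r mulr_sumr; apply: le_trans (ler_norm_sum _ _ _) _;
    apply: ler_sum => j _.
  by rewrite normrM mulrC; apply: ler_wpM2r => //; exact: smooth_partial_le.
have su : `|sin t| <= 1 by rewrite ler_norml sin_geN1 sin_le1.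
rewrite !normrM (ger0_norm s0) (mulrC k%:R) -!mulrA.
apply: (@le_trans _ _ (1 * (sigma * `|\sum_(j < k) smoothZ j j (sin t) (cos t * sigma)
  x|))).
  by apply: ler_wpM2r => //; exact: mulr_ge0.
rewrite mul1r; apply: ler_wpM2l => //; apply: le_trans (ler_norm_sum _ _ _) _.
apply: (le_trans (ler_sum _ (fun j _ => smoothZ_le j j _ _ _))).
by rewrite sumr_const card_ord mulr_natr.
Qed.

End smoothing.

(** * The bound along the rotation path *)

Section quarter_turn.
Context {R : realType}.
Variables (f f' : R -> R) (a b : R).
Hypothesis df : forall t : R, is_derive t 1 f (f' t).

(** Both [f - psi] and [- f - psi] are nonincreasing for a primitive [psi] of the bound. The open
    interval suffices, which matters since the estimate to be fed in divides by [sin t] and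
    [cos t]. *)
Lemma le_quarter_turn :
  (forall t, t \in `]0, pi / 2[ -> `|f' t| <= a * sin t + b * sin t ^+ 2) ->
  `|f (pi / 2) - f 0| <= a + b * (pi / 4).
Proof.
move=> f'le.
pose psi (t : R) := - a * cos t + b / 2 * (t - sin t * cos t).
have dpsi (t : R) : is_derive t 1 psi (a * sin t + b * sin t ^+ 2).
  apply: is_derive_eq; rewrite /GRing.scale /=.
  have -> : cos t * cos t = 1 - sin t ^+ 2 by rewrite -(cos2Dsin2 t); ring.
  by field.
have psi0 : psi 0 = - a by rewrite /psi sin0 cos0; ring.
have psi1 : psi (pi / 2) = b * (pi / 4).
  by rewrite /psi sin_pihalf cos_pihalf; field.
have hpi : 0 <= pi / 2 :> R by rewrite divr_ge0// pi_ge0.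
have d1 (t : R) : is_derive t 1 (fun t =>
  - f t - psi t) (- f' t - (a * sin t + b * sin t ^+ 2)).
  exact: is_deriveB (is_deriveN (df t)) (dpsi t).
have d2 (t : R) : is_derive t 1 (fun t =>
  f t - psi t) (f' t - (a * sin t + b * sin t ^+ 2)).
  exact: is_deriveB (df t) (dpsi t).
have h1 : - f (pi / 2) - psi (pi / 2) <= - f 0 - psi 0.
  apply: (homo_of_derive_le0 hpi d1) => t /f'le; rewrite ler_norml => /andP[+ _]; lra.
have h2 : f (pi / 2) - psi (pi / 2) <= f 0 - psi 0.
  apply: (homo_of_derive_le0 hpi d2) => t /f'le; rewrite ler_norml => /andP[_ +]; lra.
by rewrite ler_norml -psi1; apply/andP; split; lra.
Qed.

End quarter_turn.

(** * The expansion at [X] and the two conditional expectation hypotheses *)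

Section exchange.
Context {R : realType} {k : nat}.
Context d (T : measurableType d) (P : probability T R).
Variables X X' : {RV P >-> borel_mx R 1 k}.
Context d' (T' : measurableType d') (Q : probability T' R).
Variable Z : {RV Q >-> borel_mx R 1 k}.
Variable E : {RV P >-> borel_mx R k k}.
Variables sigma lambda : R.
Hypothesis hXX' : same_distribution X X'.
Hypothesis hZ : standard_gaussian Z.
Hypotheses (sigma_gt0 : 0 < sigma) (lambda_gt0 : 0 < lambda).
Hypothesis hE : P.-integrable setT (fun w => (hs_norm (E w : 'M[R]_k))%:E).
Hypothesis hlin : exists V : T -> 'rV[R]_k, is_cond_exp_mx X (increment X X') V /\
     {ae P, forall w, lambda^-1 *: V w = - (X w : 'rV[R]_k)}.
Hypothesis hquad : exists V W : T -> 'M[R]_k,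
     [/\ is_cond_exp_mx X (fun w => (increment X X' w)^T *m increment X X' w) V,
         is_cond_exp_mx X (fun w => E w : 'M[R]_k) W &
         {ae P, forall w, (2 * lambda)^-1 *: V w = (sigma ^+ 2)%:M + W w}].

Notation x j := (fun w => (X w : 'rV[R]_k) 0 j).
Notation x' j := (fun w => (X' w : 'rV[R]_k) 0 j).
Notation D := (increment X X').

Lemma measurable_x j : measurable_fun setT (x j).
Proof. exact: (measurableT_comp (measurable_coord (R := R) 0 j) (measurable_funPT X)).
  Qed.

Lemma measurable_x' j : measurable_fun setT (x' j).
Proof. exact: (measurableT_comp (measurable_coord (R := R) 0 j) (measurable_funPT X')).
  Qed.

Lemma measurable_D j : measurable_fun setT (fun w => D w 0 j).
Proof.
under eq_fun do rewrite /increment !mxE.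
by apply: measurable_funB; [exact: measurable_x'|exact: measurable_x].
Qed.

Lemma integ_D j : integ P (fun w => D w 0 j).
Proof. by have [V [cV _]] := hlin; case: (cV 0 j). Qed.

Lemma lin_ae (V : T -> 'rV[R]_k) : {ae P, forall w,
  lambda^-1 *: V w = - (X w : 'rV[R]_k)} ->
  forall j, {ae P, forall w, V w 0 j = - lambda * x j w}.
Proof.
move=> Vae j; apply: filterS Vae => w /= /(congr1 (fun v : 'rV[R]_k => v 0 j)).
rewrite !mxE => e; rewrite mulNr -mulrN -e mulrA divff ?mul1r//.
by rewrite gt_eqF.
Qed.

(** The conditional expectation [V] is integrable and equals [- lambda X] almost surely. *)
Lemma integ_x j : integ P (x j).
Proof.
have [V [cV Vae]] := hlin; have [_ iV _ _] := cV 0 j.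
apply: (integ_ae (f := fun w => - lambda^-1 * V w 0 j)); last exact: integZ.
  apply: filterS (lin_ae Vae j) => w /= ->.
  by rewrite mulrA mulrNN mulVf ?mul1r// gt_eqF.
exact: measurable_x.
Qed.

Lemma integ_x' j : integ P (x' j).
Proof.
apply: (@integ_ext _ _ _ _ (fun w => D w 0 j + x j w)).
  by move=> w; rewrite /increment !mxE subrK.
by apply: integD; [exact: integ_D|exact: integ_x].
Qed.

Lemma pull_out_lin (H : 'rV[R]_k -> R) (M : R) j : continuous H -> (forall y,
  `|H y| <= M) ->
  integ P (fun w => H (X w) * D w 0 j) /\
  (\int[P]_w (H (X w) * D w 0 j) = - lambda * \int[P]_w (H (X w) * x j w))%R.
Proof.
move=> cH HM; have mH := measurable_fun_continuous_mx cH.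
have mHX : measurable_fun setT (fun w =>
  H (X w)) by exact: measurableT_comp mH (measurable_funPT X).
have HXM w : `|H (X w)| <= M by exact: HM.
have [V [cV Vae]] := hlin; have [_ iV _ _] := cV 0 j.
split; first exact: (integM mHX HXM (integ_D j)).
rewrite (cond_exp_pull_out (cV 0 j) mH HM).
have iHx := integM mHX HXM (integ_x j).
rewrite -(RintegralZl _ measurableT iHx); apply: Rint_ae.
- apply: filterS (lin_ae Vae j) => w /= ->; ring.
- by apply: measurable_funM => //; exact: integ_measurable iV.
- by apply: measurable_funM => //; exact: integ_measurable iHx.
Qed.

Lemma integ_E i j : integ P (fun w => (E w : 'M[R]_k) i j).
Proof. by have [V [W [_ cW _]]] := hquad; case: (cW i j). Qed.

Lemma DDE w i j : ((D w)^T *m D w) i j = D w 0 i * D w 0 j.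
Proof. by rewrite mxE big_ord1 mxE. Qed.

Lemma integ_DD i j : integ P (fun w => D w 0 i * D w 0 j).
Proof.
have [V [W [cV _ _]]] := hquad; case: (cV i j) => + _ _ _.
by apply: integ_ext => w; rewrite DDE.
Qed.

Lemma pull_out_quad (H : 'rV[R]_k -> R) (M : R) i j : continuous H -> (forall y,
  `|H y| <= M) ->
  integ P (fun w => H (X w) * (D w 0 i * D w 0 j)) /\
  (\int[P]_w (H (X w) * (D w 0 i * D w 0 j)) =
   2 * lambda * (sigma ^+ 2 * (i == j)%:R * \int[P]_w H (X w) +
     \int[P]_w (H (X w) * (E w : 'M[R]_k) i j)))%R.
Proof.
move=> cH HM; have mH := measurable_fun_continuous_mx cH.
have mHX : measurable_fun setT (fun w =>
  H (X w)) by exact: measurableT_comp mH (measurable_funPT X).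
have HXM w : `|H (X w)| <= M by exact: HM.
split; first exact: (integM mHX HXM (integ_DD i j)).
have [V [W [cV cW VW]]] := hquad.
have [_ iV _ _] := cV i j; have [_ iW _ _] := cW i j.
have -> : (\int[P]_w (H (X w) * (D w 0 i * D w 0 j)) =
    \int[P]_w (H (X w) * ((D w)^T *m D w) i j))%R.
  by apply: eq_Rintegral => w _; rewrite DDE.
rewrite (cond_exp_pull_out (cV i j) mH HM) (cond_exp_pull_out (cW i j) mH HM).
have iHW := integM mHX HXM iW.
have iH : integ P (fun w => H (X w)) by exact: integ_bounded HXM.
rewrite -(RintegralZl _ measurableT iH) -(RintegralD measurableT (integZ _ iH) iHW).
have iS := integD (integZ (sigma ^+ 2 * (i == j)%:R) iH) iHW.
rewrite -(RintegralZl _ measurableT iS); apply: Rint_ae.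
- apply: filterS VW => w /= /(congr1 (fun v : 'M[R]_k => v i j)).
  rewrite !mxE -[_ *+ (i == j)]mulr_natr => e.
  have -> : V w i j = 2 * lambda * (sigma ^+ 2 * (i == j)%:R + W w i j).
    by rewrite -e mulrA divff ?mul1r// mulf_neq0 ?gt_eqF// pnatr_eq0.
  by ring.
- by apply: measurable_funM => //; exact: integ_measurable iV.
- exact: integ_measurable (integZ _ iS).
Qed.

Lemma Rint_same_distribution (u : 'rV[R]_k -> R) : continuous u ->
  integ P (fun w => u (X w)) -> integ P (fun w => u (X' w)) ->
  (\int[P]_w u (X w) = \int[P]_w u (X' w))%R.
Proof.
move=> cu iX iX'; have mu := measurable_fun_continuous_mx cu.
have mue : measurable_fun setT (EFin \o (u : borel_mx R 1 k -> R)) by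
  exact/measurable_EFinP.
rewrite /Rintegral; congr fine.
rewrite -(integral_distribution mue iX) -(integral_distribution mue iX').
by apply: eq_measure_integral => A mA _; exact: hXX'.
Qed.

Lemma measurable_enormD : measurable_fun setT (fun w => enorm (D w)).
Proof.
apply: (@measurableT_comp _ _ _ _ _ _ (@Num.sqrt R)).
  by apply: continuous_measurable_fun; exact: sqrt_continuous.
by apply: measurable_sum => i; apply: measurable_funX; exact: measurable_D.
Qed.

Variables (g : 'rV[R]_k -> R) (m1 m2 : R).
Hypothesis g2 : is_C2 g.
Hypotheses (m10 : 0 <= m1) (m20 : 0 <= m2).
Hypothesis g_lip : forall x y, `|g x - g y| <= m1 * enorm (x - y).
Hypothesis dg_lip : forall x y,
  enorm (gradient g x - gradient g y) <= m2 * enorm (x - y).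
(** With the factor [m2] inside, the case [m2 = 0] is covered even when the third moment is
    infinite. *)
Hypothesis iD3 : integ P (fun w => m2 * enorm (D w) ^+ 3).

Notation U := (smooth Z g).
Notation G j := (smooth Z (partial j g)).
Notation H := (smoothZ Z g).

Lemma integ_smoothX s r (Y : {RV P >-> borel_mx R 1 k}) :
  (forall j, integ P (fun w => (Y w : 'rV[R]_k) 0 j)) -> integ P (fun w => U s r (Y w)).
Proof.
move=> iY; pose C w := \sum_(j < k) `|(Y w : 'rV[R]_k) 0 j|.
apply: (@integ_dom _ _ _ _ _ (fun w => `|U s r 0| + m1 * `|s| * C w)).
- have /measurable_fun_continuous_mx mU := continuous_smooth hZ g2 m10 g_lip (s := s)
  (r := r).
  exact: measurableT_comp mU (measurable_funPT Y).
- move=> w; rewrite -[U s r (Y w)](subrK (U s r 0)) addrC.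
  apply: le_trans (ler_normD _ _) _; rewrite lerD2l.
  apply: le_trans (@smooth_lipschitz _ _ _ _ _ Z g m1 s r (Y w) 0 g_lip
    (fun y => integ_g hZ g2 m10 g_lip (s *: y) r)) _.
  by rewrite subr0; apply: ler_wpM2l; [exact: mulr_ge0|exact: enorm_le_sum].
- apply: integD; first exact: integ_cst.
  by apply/integZ/integ_sum => j _; exact: integ_norm.
Qed.

Let A s r := \sum_(j < k) (\int[P]_w (G j s r (X w) * x j w))%R.
Let Tr s r := \sum_(j < k) (\int[P]_w H j j s r (X w))%R.

Definition remainder s r w :=
  U s r (X' w) - U s r (X w) - s * (\sum_(j < k) D w 0 j * G j s r (X w))
    - s ^+ 2 / (2 * r) * (\sum_(j < k) \sum_(i < k) D w 0 j * D w 0 i * H i j s r (X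
      w)).

Lemma remainder_le s r w : 0 <= s -> 0 < r ->
  `|remainder s r w| <= s ^+ 3 / r * (2 * normal_peak 1) / 6 * (m2 * enorm (D w) ^+ 3).
Proof.
move=> s0 r0; have := smooth_taylor hZ g2 m10 g_lip dg_lip (X w : 'rV[R]_k) (D w) s0 r0
  m20.
have -> : (X w : 'rV[R]_k) + D w = X' w by rewrite /increment addrC subrK.
by move=> /le_trans; apply; rewrite le_eqVlt; apply/orP; left; apply/eqP; ring.
Qed.

Lemma integ_pull_out_lin s r j : integ P (fun w => G j s r (X w) * D w 0 j) /\
  (\int[P]_w (G j s r (X w) * D w 0 j) = - lambda * \int[P]_w (G j s r (X w) * x j
    w))%R.
Proof.
apply: (@pull_out_lin (G j s r) m1 j);
  first exact: (continuous_smooth_partial g2 m10 g_lip dg_lip).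
by move=> y; exact: (smooth_partial_le Z g2 m10 g_lip).
Qed.

Lemma integ_pull_out_quad s r i j : integ P (fun w =>
  H i j s r (X w) * (D w 0 j * D w 0 i)) /\
  (\int[P]_w (H i j s r (X w) * (D w 0 j * D w 0 i)) =
   2 * lambda * (sigma ^+ 2 * (j == i)%:R * \int[P]_w H i j s r (X w) +
     \int[P]_w (H i j s r (X w) * (E w : 'M[R]_k) j i)))%R.
Proof.
apply: (@pull_out_quad (H i j s r) m1 j i);
  first exact: (continuous_smoothZ hZ g2 m10 g_lip dg_lip).
by move=> y; exact: (smoothZ_le hZ g2 m10 g_lip).
Qed.

Let HE s r := (\int[P]_w \sum_(j < k) \sum_(i < k) H i j s r (X w) * (E w : 'M[R]_k) j
  i)%R.

Lemma measurable_HX i j s r : measurable_fun setT (fun w => H i j s r (X w)).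
Proof.
have cH : continuous (H i j s r) by exact: (continuous_smoothZ hZ g2 m10 g_lip dg_lip).
exact: measurableT_comp (measurable_fun_continuous_mx cH) (measurable_funPT X).
Qed.

Lemma integ_HE i j s r : integ P (fun w => H i j s r (X w) * (E w : 'M[R]_k) j i).
Proof.
apply: (integM (measurable_HX i j s r) (M := m1)); last exact: integ_E.
by move=> w; exact: (smoothZ_le hZ g2 m10 g_lip).
Qed.

Lemma integ_HX i j s r : integ P (fun w => H i j s r (X w)).
Proof.
by apply: (@integ_bounded _ _ _ _ _ m1) => [|w];
  [exact: measurable_HX|exact: (smoothZ_le hZ g2 m10 g_lip)].
Qed.

(** The two values of [U] cancel in the mean by equality of laws. The first-order term contributes
    [- lambda], the second-order one [2 lambda] against [1 / 2], so [lambda] factors out. *)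
Lemma Rint_remainder s r :
  integ P (remainder s r) /\
  (\int[P]_w remainder s r w = lambda * s * (A s r - s * sigma ^+ 2 / r * Tr s r - s /
    r * HE s r))%R.
Proof.
have iX := @integ_smoothX s r X integ_x; have iX' := @integ_smoothX s r X' integ_x'.
have iG j := (integ_pull_out_lin s r j).1.
have iH i j := (integ_pull_out_quad s r i j).1.
have iGs : integ P (fun w => \sum_(j < k) G j s r (X w) * D w 0 j) by apply: integ_sum
  => j _.
have iHi j : integ P (fun w => \sum_(i < k) H i j s r (X w) * (D w 0 j * D w 0 i)).
  by apply: integ_sum => i _.
have iHs : integ P (fun w => \sum_(j < k) \sum_(i < k) H i j s r (X w) * (D w 0 j * D w
  0 i)).
  by apply: integ_sum => j _.
have RE w : remainder s r w = U s r (X' w) - U s r (X w)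
    - s * (\sum_(j < k) G j s r (X w) * D w 0 j)
    - s ^+ 2 / (2 * r) * (\sum_(j < k) \sum_(i < k) H i j s r (X w) * (D w 0 j * D w 0
      i)).
  rewrite /remainder; congr (_ - _ * _ - _ * _).
    by apply: eq_bigr => j _; rewrite mulrC.
  by apply: eq_bigr => j _; apply: eq_bigr => i _; rewrite mulrC.
have i1 := integB iX' iX; have i2 := integB i1 (integZ s iGs).
have i3 := integB i2 (integZ (s ^+ 2 / (2 * r)) iHs).
split; first by apply: integ_ext i3 => w; rewrite RE.
under eq_Rintegral do rewrite RE.
rewrite (RintegralB measurableT i2 (integZ _ iHs)) (RintegralB measurableT i1 (integZ _
  iGs)).
rewrite (RintegralB measurableT iX' iX) (RintegralZl _ measurableT iGs) (RintegralZl _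
  measurableT iHs).
rewrite -(Rint_same_distribution _ iX iX');
  last exact: (continuous_smooth hZ g2 m10 g_lip).
rewrite subrr (Rint_sum (fun j _ => iG j)) (Rint_sum (fun j _ => iHi j)).
have -> : \sum_(j < k) (\int[P]_w (G j s r (X w) * D w 0 j))%R = - lambda * A s r.
  by rewrite /A mulr_sumr; apply: eq_bigr => j _; rewrite (integ_pull_out_lin s r j).2.
have -> : \sum_(j < k) (\int[P]_w \sum_(i < k) H i j s r (X w) * (D w 0 j * D w 0 i))%R
  =
    2 * lambda * (sigma ^+ 2 * Tr s r + HE s r).
  rewrite /HE /Tr (Rint_sum (fun j _ => integ_sum (fun i _ => integ_HE i j s r))).
  rewrite mulr_sumr -big_split /= mulr_sumr; apply: eq_bigr => j _.
  rewrite (Rint_sum (fun i _ => iH i j)) (Rint_sum (fun i _ => integ_HE i j s r)).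
  under eq_bigr do rewrite (integ_pull_out_quad s r _ j).2.
  rewrite -mulr_sumr big_split /=; congr (_ * (_ + _)).
  rewrite (bigD1 j)//= big1 ?addr0 ?eqxx ?mulr1// => i /negbTE ij.
  by rewrite eq_sym ij mulr0 mul0r.
(* Here [r] may vanish; naming its inverse lets [field] treat it as an atom. *)
by rewrite invfM; set q := r^-1; field.
Qed.

(** Cauchy-Schwarz over pairs of indices at each [w], with [smoothZ_sqr_le] for the first factor. *)
Lemma HE_le s r : `|HE s r| <= m1 * (\int[P]_w hs_norm (E w : 'M[R]_k))%R.
Proof.
rewrite -(RintegralZl _ measurableT hE); apply: Rint_abs_le.
- by apply: integ_measurable (integ_sum _) => j _; apply: integ_sum => i _;
  exact: integ_HE.
- exact: integZ hE.
move=> w; rewrite !pair_big /=.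
have S1 : \sum_(p : 'I_k * 'I_k) H p.2 p.1 s r (X w) ^+ 2 <= m1 ^+ 2.
  have := smoothZ_sqr_le hZ g2 m10 g_lip s r (X w : 'rV[R]_k).
  by rewrite pair_big.
have S2 : \sum_(p : 'I_k * 'I_k) (E w : 'M[R]_k) p.1 p.2 ^+ 2 = hs_norm (E w : 'M[R]_k)
  ^+ 2.
  rewrite /hs_norm sqr_sqrtr.
    rewrite -(pair_big xpredT xpredT (fun i j => (E w : 'M[R]_k) i j ^+ 2)) /=.
    by apply: eq_bigr => i _; rewrite mxE; apply: eq_bigr => j _; rewrite mxE expr2.
  by apply: sumr_ge0 => i _; rewrite mxE; apply: sumr_ge0 => j _;
    rewrite mxE -expr2 sqr_ge0.
rewrite -(@ler_pXn2r _ 2)// ?nnegrE ?mulr_ge0 ?sqrtr_ge0//.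
rewrite real_normK ?num_real// exprMn -S2.
apply: le_trans (sqr_sum_le _ _) _; apply: ler_wpM2r => //.
by apply: sumr_ge0 => p _; exact: sqr_ge0.
Qed.

(** [Rint_remainder] is solved for the path derivative after multiplication by
    [cos t / (lambda sin t)]. The coefficient of the remainder bound becomes [(cos t / (lambda s))
    (s^3 / r) = s^2 / (lambda sigma)], free of [1 / cos t]. *)
Lemma stein_identity_le (t : R) : 0 < sin t -> 0 < cos t ->
  `|cos t * A (sin t) (cos t * sigma) - sin t * sigma * Tr (sin t) (cos t * sigma)|
  <= m1 * (\int[P]_w hs_norm (E w : 'M[R]_k))%R / sigma * sin t +
     (2 * normal_peak 1) * (\int[P]_w (m2 * enorm (D w) ^+ 3))%R / (6 * lambda * sigma)
       * sin t ^+ 2.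
Proof.
set s := sin t; set c := cos t => s0 c0; set r := c * sigma.
have r0 : 0 < r by exact: mulr_gt0.
have [iR ER] := Rint_remainder s r.
have Rle : `|\int[P]_w remainder s r w|%R <=
    s ^+ 3 / r * (2 * normal_peak 1) / 6 * (\int[P]_w (m2 * enorm (D w) ^+ 3))%R.
  rewrite -(RintegralZl _ measurableT iD3); apply: Rint_abs_le.
  - exact: integ_measurable iR.
  - exact: integZ.
  - by move=> w; apply: remainder_le => //; exact: ltW.
have Hle := HE_le s r.
set IR := (\int[P]_w remainder s r w)%R in ER Rle *.
set B := (\int[P]_w (m2 * enorm (D w) ^+ 3))%R in Rle *.
set hs := (\int[P]_w hs_norm (E w : 'M[R]_k))%R in Hle *.
have nz : [/\ s != 0, c != 0, sigma != 0 & lambda != 0] by rewrite !gt_eqF.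
have -> : c * A s r - s * sigma * Tr s r = s / sigma * HE s r + c / (lambda * s) * IR.
  rewrite ER /r; case: nz => ? ? ? ?; field.
  by apply/and4P.
apply: le_trans (ler_normD _ _) _; rewrite !normrM.
have p1 : 0 < s / sigma by exact: divr_gt0.
have p2 : 0 < c / (lambda * s) by rewrite divr_gt0// mulr_gt0.
rewrite -!normrM !normrM -(normrM s) -(normrM c) (gtr0_norm p1) (gtr0_norm p2);
  apply: lerD.
  apply: le_trans (ler_wpM2l (ltW p1) Hle) _; rewrite le_eqVlt; apply/orP; left;
    apply/eqP; ring.
apply: le_trans (ler_wpM2l (ltW p2) Rle) _; rewrite le_eqVlt; apply/orP; left;
  apply/eqP.
rewrite /r; case: nz => ? ? ? ?; field.
by apply/and4P.
Qed.

Let phi (t : R) := (\int[P]_w U (sin t) (cos t * sigma) (X w))%R.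

Lemma is_derive_phi (t : R) : is_derive t 1 phi
  (cos t * A (sin t) (cos t * sigma) - sin t * sigma * Tr (sin t) (cos t * sigma)).
Proof.
pose f (t : R) w := U (sin t) (cos t * sigma) (X w).
pose f' (t : R) w := cos t * (\sum_(j < k) (X w : 'rV[R]_k) 0 j * G j (sin t) (cos t *
  sigma) (X w))
     - sin t * sigma * (\sum_(j < k) H j j (sin t) (cos t * sigma) (X w)).
pose bnd w := m1 * (\sum_(j < k) `|x j w|) + k%:R * (sigma * m1).
have if_ u : integ P (f u) by exact: integ_smoothX integ_x.
have df (u : R) w : is_derive u 1 (f^~ w) (f' u w).
  exact: (is_derive_rotation hZ g2 m10 g_lip).
have f'b u w : `|f' u w| <= bnd w.
  exact: (rotation_derive_le hZ g2 m10 g_lip u (X w : 'rV[R]_k) (ltW sigma_gt0)).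
have ib : integ P bnd.
  apply: integD; last exact: integ_cst.
  by apply/integZ/integ_sum => j _; apply: integ_norm; exact: integ_x.
have D1 := is_derive_under_integral t if_ df f'b ib.
apply: (is_derive_eq D1).
set s := sin t; set r := cos t * sigma.
have iG j : integ P (fun w => G j s r (X w) * x j w).
  have cG : continuous (G j s r) by exact: (continuous_smooth_partial g2 m10 g_lip
    dg_lip).
  apply: (integM (measurableT_comp (measurable_fun_continuous_mx cG) (measurable_funPT
    X)) (M := m1)).
    by move=> w; exact: (smooth_partial_le Z g2 m10 g_lip).
  exact: integ_x.
have i1 : integ P (fun w => \sum_(j < k) G j s r (X w) * x j w) by apply: integ_sum =>
  j _.
have i2 : integ P (fun w => \sum_(j < k) H j j s r (X w)) by apply: integ_sum => j _;
  exact: integ_HX.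
transitivity (\int[P]_w (cos t * (\sum_(j < k) G j s r (X w) * x j w) - s * sigma *
  (\sum_(j < k) H j j s r (X w))))%R.
  apply: eq_Rintegral => w _; rewrite /f'; congr (_ * _ - _).
  by apply: eq_bigr => j _; rewrite mulrC.
rewrite (RintegralB measurableT (integZ _ i1) (integZ _ i2)).
rewrite (RintegralZl _ measurableT i1) (RintegralZl _ measurableT i2).
by rewrite (Rint_sum (fun j _ => iG j)) (Rint_sum (fun j _ => integ_HX j j s r)).
Qed.

(** Turns the product of [sqrt(2 / pi) / 6] and [pi / 4] into [sqrt(2 pi) / 24]. *)
Lemma normal_peak1_pi : 2 * normal_peak 1 * pi = Num.sqrt (2 * pi) :> R.
Proof.
have p0 : 0 < 2 * pi :> R by rewrite mulr_gt0// pi_gt0.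
rewrite /normal_peak expr1n mul1r (_ : pi *+ 2 = 2 * pi); last by rewrite mulr_natl.
have s0 : Num.sqrt (2 * pi) != 0 :> R by rewrite gt_eqF// sqrtr_gt0.
rewrite mulrAC; apply: (mulIf s0); rewrite divfK// -expr2 sqr_sqrtr// ltW//.
Qed.

Lemma stein_bound :
  `|(\int[P]_w g (X w))%R - (\int[Q]_w g (sigma *: (Z w : 'rV[R]_k)))%R|
  <= sigma^-1 * m1 * (\int[P]_w hs_norm (E w : 'M[R]_k))%R +
     Num.sqrt (2 * pi) / (24 * sigma) * lambda^-1 * (\int[P]_w (m2 * enorm (D w) ^+
       3))%R.
Proof.
set hs := (\int[P]_w hs_norm _)%R; set B := (\int[P]_w (m2 * _))%R.
(* At [pi / 2] the Gaussian has weight [0], so the inner integral is that of a constant. *)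
have -> : (\int[P]_w g (X w) = phi (pi / 2))%R.
  rewrite /phi sin_pihalf cos_pihalf mul0r; apply: eq_Rintegral => w _.
  rewrite /smooth -[LHS](Rint_cst Q); apply: eq_Rintegral => v _.
  by rewrite scale1r scale0r addr0.
have -> : (\int[Q]_w g (sigma *: (Z w : 'rV[R]_k)) = phi 0)%R.
  rewrite /phi sin0 cos0 mul1r -[LHS](Rint_cst P); apply: eq_Rintegral => w _.
  by apply: eq_Rintegral => v _; rewrite scale0r add0r.
pose a := m1 * hs / sigma.
pose b := 2 * normal_peak 1 * B / (6 * lambda * sigma).
have -> : sigma^-1 * m1 * hs + Num.sqrt (2 * pi) / (24 * sigma) * lambda^-1 * B = a + b
  * (pi / 4).
  rewrite -normal_peak1_pi /a /b; field.
  by rewrite !gt_eqF.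
apply: (le_quarter_turn is_derive_phi) => t /[!in_itv]/= /andP[t0 t1].
have st : 0 < sin t.
  by apply: sin_gt0_pi; rewrite t0 (lt_le_trans t1)// ler_pdivrMr// ler_peMr ?pi_ge0//
    ler1n.
have ct : 0 < cos t.
  by apply: cos_gt0_pihalf; rewrite t1 andbT (lt_trans _ t0)// oppr_lt0 divr_gt0//
    pi_gt0.
exact: stein_identity_le.
Qed.

End exchange.

(** * Lipschitz constants as suprema *)

Section lipschitz_constants.
Context {R : realType} {k : nat}.

Lemma enorm0 : enorm (0 : 'rV[R]_k) = 0.
Proof. by rewrite -(scale0r (0 : 'rV[R]_k)) enormZ normr0 mul0r. Qed.

(** For [k = 0] there are no distinct points and the supremum is [-oo]; a positive dimension makes
    it nonnegative. *)
Lemma ereal_sup_quotient (f : 'rV[R]_k -> 'rV[R]_k -> R) : (0 < k)%N ->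
  (forall x y, 0 <= f x y) -> (forall x, f x x = 0) ->
  let S := [set (f p.1 p.2 / enorm (p.1 - p.2))%:E
           | p in [set p : 'rV[R]_k * 'rV[R]_k | p.1 <> p.2]] in
  (ereal_sup S < +oo)%E ->
  exists m : R, [/\ ereal_sup S = m%:E, 0 <= m &
    forall x y, f x y <= m * enorm (x - y)].
Proof.
move=> kp f0 fxx S Slt.
pose e : 'rV[R]_k := delta_mx 0 (Ordinal kp).
have S0 : (0 <= ereal_sup S)%E.
  apply: (@le_trans _ _ (f e 0 / enorm (e - 0))%:E).
    by rewrite lee_fin divr_ge0.
  apply: ereal_sup_ubound; exists (e, 0) => //= e0.
  by have := enorm_delta (R := R) (Ordinal kp); rewrite -/e e0 enorm0 => /esym/eqP;
    rewrite oner_eq0.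
have Sfin : ereal_sup S \is a fin_num by rewrite ge0_fin_numE.
exists (fine (ereal_sup S)); rewrite fineK//; split=> //; first exact: fine_ge0.
move=> x y; have [->|xy] := eqVneq x y.
  by rewrite fxx subrr mulr_ge0 ?fine_ge0.
have n0 : 0 < enorm (x - y).
  rewrite lt_neqAle enorm_ge0 andbT eq_sym; apply/eqP => /enorm_eq0/eqP.
  by rewrite subr_eq0 (negbTE xy).
rewrite -ler_pdivrMr// -lee_fin fineK//.
by apply: ereal_sup_ubound; exists (x, y) => //=; apply/eqP.
Qed.

End lipschitz_constants.

(** Beyond [stein_bound], the extended reals leave three degenerate cases: dimension [0], a
    vanishing [M2 g], and an infinite third moment. *)
Theorem theorem4 (R : realType) (k : nat)
  (d : measure_display) (T : measurableType d) (P : probability T R)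
  (X X' : {RV P >-> borel_mx R 1 k})
  (d' : measure_display) (T' : measurableType d') (Q : probability T' R)
  (Z : {RV Q >-> borel_mx R 1 k})
  (E : {RV P >-> borel_mx R k k})
  (sigma lambda : R)
  (hXX' : same_distribution X X')
  (hZ : standard_gaussian Z)
  (sigma_gt0 : 0 < sigma) (lambda_gt0 : 0 < lambda)
  (hD2 : P.-integrable setT (fun w => (enorm (increment X X' w) ^+ 2)%:E))
  (hE : P.-integrable setT (fun w => (hs_norm (E w : 'M[R]_k))%:E))
  (hlin : exists V : T -> 'rV[R]_k, is_cond_exp_mx X (increment X X') V /\
     {ae P, forall w, lambda^-1 *: V w = - (X w : 'rV[R]_k)})
  (hquad : exists V W : T -> 'M[R]_k,
     [/\ is_cond_exp_mx X (fun w => (increment X X' w)^T *m increment X X' w) V,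
         is_cond_exp_mx X (fun w => E w : 'M[R]_k) W &
         {ae P, forall w, (2 * lambda)^-1 *: V w = (sigma ^+ 2)%:M + W w}])
  (g : 'rV[R]_k -> R) :
  is_C2 g -> (M1 g < +oo)%E -> (M2 g < +oo)%E ->
  (`| 'E_P[fun w => g (X w : 'rV[R]_k)] -
      'E_Q[fun w => (g (sigma *: (Z w : 'rV[R]_k)))%R] | <=
   (sigma^-1)%:E * M1 g * 'E_P[fun w => hs_norm (E w : 'M[R]_k)] +
   (Num.sqrt (2 * pi) / (24 * sigma))%:E * (M2 g * (lambda^-1)%:E) *
     'E_P[fun w => (enorm (increment X X' w) ^+ 3)%R])%E.
Proof.
move=> g2 M1lt M2lt; have [k0|kp] := posnP k.
  (* In dimension [0] the suprema are [-oo], but they are multiplied by expectations equal to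
     [0]. *)
  have x0 (x : 'rV[R]_k) : x = 0.
    by apply/rowP => i; have := ltn_ord i; rewrite [X in (_ < X)%N]k0.
  have -> : (fun w => g (X w : 'rV[R]_k)) = cst (g 0) by apply/funext => w;
    rewrite (x0 (X w)).
  have -> : (fun w => g (sigma *: (Z w : 'rV[R]_k))) = cst (g 0) by apply/funext => w;
    rewrite (x0 (_ *: _)).
  have -> : (fun w => hs_norm (E w : 'M[R]_k)) = cst 0.
    apply/funext => w; rewrite /hs_norm (_ : \tr _ = 0) ?sqrtr0//.
    by apply: big1 => i; have := ltn_ord i; rewrite [X in (_ < X)%N]k0.
  have -> : (fun w => enorm (increment X X' w) ^+ 3) = cst 0.
    apply/funext => w; by rewrite (x0 (increment X X' w)) enorm0 expr0n.
  by rewrite !expectation_cst !mule0 adde0 subee// abse0.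
have g0 x : `|g x - g x| = 0 by rewrite subrr normr0.
have dg0 x : enorm (gradient g x - gradient g x) = 0 by rewrite subrr enorm0.
have [m1 [M1E m10 g_lip]] := ereal_sup_quotient kp (fun x y =>
  normr_ge0 (g x - g y)) g0 M1lt.
have [m2 [M2E m20 dg_lip]] :=
  ereal_sup_quotient kp (fun x y => enorm_ge0 (gradient g x - gradient g y)) dg0 M2lt.
rewrite /M1 M1E /M2 M2E.
have igX : integ P (fun w => g (X w : 'rV[R]_k)).
  (* The smoothing with [s = 1] and [r = 0] is [g] itself. *)
  apply: integ_ext (integ_smoothX hZ g2 m10 g_lip 1 0 (integ_x lambda_gt0 hlin)) => w.
  rewrite /smooth -[RHS](Rint_cst Q); apply: eq_Rintegral => v _.
  by rewrite scale1r scale0r addr0.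
have igZ : integ Q (fun w => g (sigma *: (Z w : 'rV[R]_k))).
  by apply: integ_ext (integ_g hZ g2 m10 g_lip 0 sigma) => w; rewrite add0r.
have EI d1 (T1 : measurableType d1) (P1 : probability T1 R) (f : T1 -> R) :
    integ P1 f -> ('E_P1[f])%E = ((\int[P1]_w f w)%R)%:E.
  by move=> fi; rewrite unlock /Rintegral fineK// integrable_fin_num.
rewrite (EI _ _ _ _ igX) (EI _ _ _ _ igZ) (EI _ _ _ _ hE) -EFinB [X in (X <= _)%E]/=.
have mD3 : measurable_fun setT (fun w => enorm (increment X X' w) ^+ 3).
  by apply: measurable_funX; exact: measurable_enormD.
have bound iD3 := @stein_bound R k d T P X X' d' T' Q Z E sigma lambda hXX' hZ
  sigma_gt0 lambda_gt0
  hE hlin hquad g m1 m2 g2 m10 m20 g_lip dg_lip iD3.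
have hs0 : 0 <= (\int[P]_w hs_norm (E w : 'M[R]_k))%R.
  by apply: Rintegral_ge0 => w _; exact: sqrtr_ge0.
(* Here the last term is [0] by the convention for [0] times [+oo], whatever the third moment. *)
have [m2_0|m2n0] := eqVneq m2 0.
  have i0 : integ P (fun w => m2 * enorm (increment X X' w) ^+ 3).
    apply: (@integ_ext _ _ _ _ (fun=> 0)); last exact: integ_cst.
    by move=> w; rewrite m2_0 mul0r.
  apply: (@le_trans _ _ (sigma^-1 * m1 * (\int[P]_w hs_norm (E w : 'M[R]_k))%R)%:E).
    have B0 : (\int[P]_w (m2 * enorm (increment X X' w) ^+ 3))%R = 0.
      rewrite -[RHS](Rint_cst P); apply: eq_Rintegral => w _.
      by rewrite m2_0 mul0r.
    by rewrite lee_fin; apply: le_trans (bound i0) _; rewrite B0 mulr0 addr0.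
  by rewrite m2_0 mul0e mule0 mul0e adde0 -!EFinM.
have m2gt0 : 0 < m2 by rewrite lt_neqAle eq_sym m2n0.
have c0 : 0 < Num.sqrt (2 * pi) / (24 * sigma) * (m2 * lambda^-1).
  by rewrite !mulr_gt0 ?invr_gt0 ?sqrtr_gt0 ?mulr_gt0 ?pi_gt0.
have E30 : (0 <= 'E_P[fun w => (enorm (increment X X' w) ^+ 3)%R])%E.
  by apply: expectation_ge0 => w; apply: exprn_ge0.
(* An infinite third moment with a positive coefficient makes the right side [+oo]. *)
have [Elt|] := ltP ('E_P[fun w => (enorm (increment X X' w) ^+ 3)%R])%E +oo%E;
  last first.
  rewrite leye_eq => /eqP ->; rewrite -!EFinM gt0_muley ?lte_fin// addey ?leey//.
have iD3 : integ P (fun w => enorm (increment X X' w) ^+ 3).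
  apply/integrableP; split; first exact/measurable_EFinP.
  move: Elt; rewrite unlock; congr (_ < _)%E; apply: eq_integral => w _.
  by rewrite gee0_abs// lee_fin exprn_ge0.
rewrite (EI _ _ _ _ iD3) -!EFinM -EFinD lee_fin;
  apply: le_trans (bound (integZ m2 iD3)) _.
by rewrite (RintegralZl _ measurableT iD3) le_eqVlt; apply/orP; left; apply/eqP; ring.
Qed.
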